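(* Let $P$ be an orthogonal projection in a $W^\star$-non commutative probability space $(\mathscr{A},\tau)$ with $\tau(P)=\theta\in(0,1]$, let $S=2P-{\bf 1}$ and $\kappa=\tau(S)=2\theta-1$, and let $U\in\mathscr{A}$ be a Haar unitary $\star$-free from $P$. Then the Lebesgue decomposition of the spectral distribution $\mu_\infty$ of the unitary operator $SUSU^\star$ on the unit circle, whose points are written $z=e^{i\psi}$, is given by $$\mu_\infty=|\kappa|\,\delta_1+\sqrt{1-\frac{\kappa^2}{\sin^2\psi}}\;{\bf 1}_{\{|\sin\psi|\ge|\kappa|\}}\,d\psi,$$ where $\delta_1$ is the Dirac mass at $z=1$ and $d\psi$ stands for the Haar distribution (normalized to total mass one) on the unit circle.
   Context: A $W^\star$-non commutative probability space $(\mathscr{A},\tau)$ is a von Neumann algebra $\mathscr{A}$ with unit ${\bf 1}$ endowed with a faithful tracial state $\tau$. A Haar unitary is a unitary $U$ with $\tau(U^k)=0$ for all $k\in\mathbb{Z}\setminus\{0\}$; $\star$-freeness is in Voiculescu's sense. The spectral distribution $\mu_\infty$ is the probability measure on the unit circle with $\int z^n\mu_\infty(dz)=\tau[(SUSU^\star)^n]$ for all $n\in\mathbb{Z}$.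
   Formalization: The density is taken in the coordinate z=e^{2iψ} (ψ is half the argument of z) instead of z=e^{iψ}: with z=e^{iψ} the printed measure has first moment |κ|, while freeness gives τ(SUSU* )=κ², so the printed formula fails for 0<|κ|<1. *)

(* Defs.v *)
From HB Require Import structures.
From mathcomp Require Import all_boot all_order all_algebra.
From mathcomp Require Import complex.
From mathcomp Require Import all_classical all_reals all_analysis.

Set Implicit Arguments.
Unset Strict Implicit.
Unset Printing Implicit Defensive.

Import Order.TTheory GRing.Theory Num.Theory.
Import numFieldNormedType.Exports.

Local Open Scope classical_set_scope.
Local Open Scope ring_scope.
Local Open Scope complex_scope.

Section Hilbert.
Context (R : realType) (H : lmodType R[i]) (dot : {dot H for Num.conj}).

Definition hnorm (x : H) : R := Num.sqrt (complex.Re (dot x x)).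

Definition hilbert_complete : Prop :=
  forall u : nat -> H,
    (forall e : R, 0 < e -> exists N : nat, forall m n : nat,
       (N <= m)%N -> (N <= n)%N -> hnorm (u m - u n) < e) ->
    exists l : H, forall e : R, 0 < e -> exists N : nat, forall n : nat,
       (N <= n)%N -> hnorm (u n - l) < e.

Definition bounded_operator (T : {linear H -> H}) : Prop :=
  exists M : R, forall x : H, hnorm (T x) <= M * hnorm x.

Definition in_weak_operator_closure (S : set {linear H -> H})
    (T : {linear H -> H}) : Prop :=
  forall (s : seq (H * H)) (e : R), 0 < e ->
    exists2 T' : {linear H -> H}, S T' &
      forall p : H * H, p \in s -> `|dot (T p.1 - T' p.1) p.2| < e%:C.

End Hilbert.

Section StarAlgebra.
Context (R : realType) (A : algType R[i]) (star : A -> A).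

Definition star_involution : Prop :=
  [/\ forall (c : R[i]) (a b : A), star (c *: a + b) = c^* *: star a + star b,
      forall a b : A, star (a * b) = star b * star a
    & forall a : A, star (star a) = a].

Definition star_representation (H : lmodType R[i])
    (dot : {dot H for Num.conj}) (rep : A -> {linear H -> H}) : Prop :=
  [/\ forall (c : R[i]) (a b : A) (x : H),
        rep (c *: a + b) x = c *: rep a x + rep b x,
      forall (a b : A) (x : H), rep (a * b) x = rep a (rep b x),
      forall x : H, rep 1 x = x,
      forall (a : A) (x y : H), dot (rep a x) y = dot x (rep (star a) y)
    & forall a : A, bounded_operator dot (rep a)].

(* A is, up to a faithful unital *-representation, a *-algebra of bounded
   operators on a complex Hilbert space containing the identity and closed in
   the weak operator topology. *)
Definition von_neumann_algebra : Prop :=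
  star_involution /\
  exists (H : lmodType R[i]) (dot : {dot H for Num.conj})
         (rep : A -> {linear H -> H}),
    [/\ hilbert_complete dot,
        star_representation dot rep,
        forall a : A, (forall x : H, rep a x = 0) -> a = 0
      & forall T : {linear H -> H}, bounded_operator dot T ->
          in_weak_operator_closure dot (range rep) T ->
          exists a : A, forall x : H, rep a x = T x].

Definition faithful_tracial_state (tau : {scalar A}) : Prop :=
  [/\ tau 1 = 1,
      forall a : A, 0 <= tau (star a * a),
      forall a : A, tau (star a * a) = 0 -> a = 0
    & forall a b : A, tau (a * b) = tau (b * a)].

Definition wstar_probability_space (tau : {scalar A}) : Prop :=
  von_neumann_algebra /\ faithful_tracial_state tau.

Definition orthogonal_projection (p : A) : Prop := star p = p /\ p * p = p.

Definition unitary (u : A) : Prop := u * star u = 1 /\ star u * u = 1.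

(* Integer powers of a unitary, whose inverse is its adjoint. *)
Definition upow (u : A) (n : int) : A :=
  match n with Posz m => u ^+ m | Negz m => star u ^+ m.+1 end.

Definition haar_unitary (tau : {scalar A}) (u : A) : Prop :=
  unitary u /\ forall k : int, k != 0 -> tau (upow u k) = 0.

Definition unital_star_subalgebra (B : set A) : Prop :=
  [/\ B 1,
      forall (c : R[i]) (a b : A), B a -> B b -> B (c *: a + b),
      forall a b : A, B a -> B b -> B (a * b)
    & forall a : A, B a -> B (star a)].

Definition star_subalgebra_generated (x : A) : set A :=
  [set a | forall B : set A, unital_star_subalgebra B -> B x -> B a].

(* The word [:: (i_1, a_1); ...; (i_n, a_n)] stands for the product a_1 ... a_n
   with a_k in the i_k-th algebra. *)
Definition free_family (tau : {scalar A}) (I : eqType) (B : I -> set A) : Prop :=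
  forall w : seq (I * A),
    w != [::] ->
    sorted (fun p q : I * A => p.1 != q.1) w ->
    (forall p : I * A, p \in w -> B p.1 p.2 /\ tau p.2 = 0) ->
    tau (\prod_(p <- w) p.2) = 0.

Definition star_free (tau : {scalar A}) (x y : A) : Prop :=
  free_family tau (fun b : bool =>
    if b then star_subalgebra_generated x else star_subalgebra_generated y).

End StarAlgebra.

Section Circle.
Context (R : realType).

Record circle := Circle { circle_val :> R[i]; _ : `|circle_val| == 1 }.

HB.instance Definition _ := [isSub for circle_val].
HB.instance Definition _ := [Choice of circle by <:].

Lemma circle_exp_subproof (t : R) : `|cos t +i* sin t| == 1 :> R[i].
Proof. by rewrite normc_def /= cos2Dsin2 sqrtr1. Qed.

Definition circle_exp (t : R) : circle := Circle (circle_exp_subproof t).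

Definition circle_coord (z : circle) : R * R :=
  (complex.Re z, complex.Im z).

HB.instance Definition _ := isPointed.Build circle (circle_exp 0).

(* The Borel sigma-algebra of the circle is the trace of that of the plane. *)
HB.instance Definition _ :=
  Measurable.copy circle (g_sigma_algebra_preimageType circle_coord).

Definition circle_one : circle := circle_exp 0.

Definition circle_moment (mu : {measure set circle -> \bar R}) (n : int) : R[i] :=
  (\int[mu]_z complex.Re (circle_val z ^ n))
  +i* (\int[mu]_z complex.Im (circle_val z ^ n)).

Lemma two_pi_gt0 : 0 < 2 * pi :> R.
Proof. by rewrite mulr_gt0 ?pi_gt0. Qed.

Definition haar_circle : set circle -> \bar R :=
  pushforward (uniform_prob two_pi_gt0) circle_exp.

End Circle.

Definition mutually_singular d (T : measurableType d) (R : realType)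
    (m1 m2 : set T -> \bar R) : Prop :=
  exists N : set T, [/\ measurable N, m1 N = 0%E & m2 (~` N) = 0%E].

Definition lebesgue_decomposition d (T : measurableType d) (R : realType)
    (nu mu mu_s mu_ac : set T -> \bar R) : Prop :=
  [/\ forall B : set T, measurable B -> mu B = (mu_s B + mu_ac B)%E,
      mu_ac `<< nu
    & mutually_singular nu mu_s].

Definition spectral_density (R : realType) (kappa psi : R) : R :=
  Num.sqrt (1 - kappa ^+ 2 / sin psi ^+ 2)
  * \1_[set t : R | `|kappa| <= `|sin t|] psi.

(* The measure f(psi) dpsi, with dpsi the normalized Haar distribution, in the
   coordinate z = e^{2 i psi}: psi is half the argument of z, so that psi
   ranging over [0, 2 pi] covers the circle twice, with total mass one.
   Such a coordinate is forced for f = spectral_density kappa. In z = e^{i psi},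
   the symmetry psi -> pi - psi would give the measure
   |kappa| delta_1 + f(psi) dpsi the first moment |kappa|, whereas freeness
   gives tau (S U S U^* ) = tau (S) ^ 2 = kappa ^ 2. *)
Definition half_angle_measure (R : realType) (f : R -> R)
    (B : set (circle R)) : \bar R :=
  (\int[uniform_prob (two_pi_gt0 R)]_(psi in (fun t : R => circle_exp (2 * t)) @^-1` B)
     (f psi)%:E)%E.

(* Main.v *)
Require Import Defs.
From HB Require Import structures.
From mathcomp Require Import all_boot all_order all_algebra.
From mathcomp Require Import complex.
From mathcomp Require Import all_classical all_reals all_analysis.
From mathcomp Require Import measurable_realfun.
From mathcomp Require Import ring lra.

(* Put a = S, b = U S U^* and u = a b. Freeness says that M = (a - kappa)(b - kappa)
   satisfies tau (M^n) = 0 for n >= 1. Since a^2 = b^2 = 1, the element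
   N = (b + kappa)(a + kappa) satisfies M N = N M = (1 - kappa^2)^2 and
   M + N = u + u^-1 + 2 kappa^2, so that M^n + N^n = 2 q_n ((u + u^-1) / 2) for a
   rescaled Chebyshev polynomial q_n of degree n. Moreover, M^n and
   ((a + kappa)(b + kappa))^n, which has the same trace as N^n, have equal even
   parts and opposite odd parts as combinations of words in a and b, and every
   odd word is conjugate to a or b, hence has trace kappa; this gives
   tau (N^n), and thus the integrals of all q_n (Re z), which
   determine mu_infty together with its invariance under conjugation.

   On the side of the explicit measure, the substitution
   cos psi = sqrt (1 - kappa^2) cos chi maps q_n (cos (2 psi)) to
   (1 - kappa^2)^n cos (2 n chi) and the density, up to
   the factor dpsi / dchi, to 1 - |kappa| times a Poisson
   kernel of radius (1 - |kappa|) / (1 + |kappa|), whose Fourier coefficients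
   are explicit, and the two families of integrals agree. *)

Set Implicit Arguments.
Unset Strict Implicit.
Unset Printing Implicit Defensive.

Import Order.TTheory GRing.Theory Num.Theory.
Import numFieldNormedType.Exports.

Local Open Scope classical_set_scope.
Local Open Scope ring_scope.
Local Open Scope complex_scope.

(** * Chebyshev recursion and traces of two free symmetries *)

(* [cheb x 1 n] is the n-th Chebyshev polynomial of the first kind at [x]. *)
Fixpoint cheb (T : pzRingType) (x d : T) (n : nat) : T :=
  if n is m.+1 then
    if m is l.+1 then x *+ 2 * cheb x d m - d * cheb x d l else x
  else 1.

Lemma cheb_rec (T : pzRingType) (x d : T) (n : nat) :
  cheb x d n.+2 = x *+ 2 * cheb x d n.+1 - d * cheb x d n.
Proof. by []. Qed.

Lemma nat_ind2 (Q : nat -> Prop) :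
  Q 0 -> Q 1 -> (forall n, Q n -> Q n.+1 -> Q n.+2) -> forall n, Q n.
Proof.
move=> Q0 Q1 QS n; suff : Q n /\ Q n.+1 by case.
by elim: n => [|n [Qn QSn]]; split=> //; exact: QS.
Qed.

Lemma rmorph_cheb (T T' : pzRingType) (f : {rmorphism T -> T'}) x d n :
  f (cheb x d n) = cheb (f x) (f d) n.
Proof.
elim/nat_ind2: n => [|//|n IH0 IH1]; first by rewrite /= rmorph1.
by rewrite !cheb_rec rmorphB !rmorphM rmorphMn IH0 IH1.
Qed.

Lemma cheb_pair (T : pzRingType) (p r x d : T) (n : nat) :
  p + r = x *+ 2 -> p * r = d -> r * p = d ->
  p ^+ n + r ^+ n = cheb x d n *+ 2.
Proof.
move=> prx prd rpd; elim/nat_ind2: n => [|//|n IH0 IH1]; first by rewrite !expr0.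
rewrite cheb_rec mulrnBl -!mulrnAr -IH0 -IH1 -prx mulrDl !mulrDr.
have -> : p * r ^+ n.+1 = d * r ^+ n by rewrite exprS mulrA prd.
have -> : r * p ^+ n.+1 = d * p ^+ n by rewrite exprS mulrA rpd.
by rewrite -!exprS (addrC (d * p ^+ n)) addrACA (addrC (d * r ^+ n)) addrK.
Qed.

Lemma size_cheb (F : numFieldType) (e d : F) (n : nat) :
  size (cheb ('X + e%:P) d%:P n) = n.+1.
Proof.
elim/nat_ind2: n => [||n IH0 IH1]; first by rewrite size_poly1.
  by rewrite /= size_XaddC.
have s2 : size (('X + e%:P) *+ 2 * cheb ('X + e%:P) d%:P n.+1) = n.+3.
  rewrite mulrnAl -scaler_nat size_scale ?pnatr_eq0//.
  by rewrite size_monicM ?monicXaddC// -?size_poly_eq0 IH1// size_XaddC.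
rewrite cheb_rec size_polyDl s2// size_polyN mul_polyC.
by rewrite (leq_ltn_trans (size_scale_leq _ _))// IH0.
Qed.

Lemma poly_graded_ind (F : fieldType) (q : nat -> {poly F})
    (Q : {poly F} -> Prop) :
  (forall n, size (q n) = n.+1) -> Q 0 ->
  (forall c p r, Q p -> Q r -> Q (c *: p + r)) ->
  (forall n, Q (q n)) -> forall p, Q p.
Proof.
move=> sq Q0 QD Qq p; have [n] := ubnP (size p).
elim: n p => // n IH p; rewrite ltnS leq_eqVlt => /orP[/eqP sp|/IH//].
have [p0|p0] := eqVneq p 0; first by rewrite p0.
case: n sp IH => [/eqP|n sp IH]; first by rewrite size_poly_eq0 (negbTE p0).
have q0 : lead_coef (q n) != 0 by rewrite lead_coef_eq0 -size_poly_eq0 sq.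
set c := lead_coef p / lead_coef (q n).
rewrite -[p](subrKC (c *: q n)).
apply: QD => //; apply: IH; rewrite ltnS.
apply/leq_sizeP => j; rewrite leq_eqVlt => /orP[/eqP<-|nj]; last first.
  by rewrite coefB coefZ !nth_default ?sp ?sq ?mulr0 ?subrr.
rewrite coefB coefZ /c /lead_coef sp sq /= divfK ?subrr//.
by rewrite /lead_coef sq in q0.
Qed.

Section SymmetryWords.
Variables (F : numFieldType) (A : algType F) (a b : A).
Hypotheses (aa : a * a = 1) (bb : b * b = 1).

(* Every odd word will have the same trace [k], so that only the sum [s] of the
   coefficients of a combination of odd words matters for its trace. *)
Inductive parity_sum (odd_part : bool) : A -> F -> Prop :=
| ParitySum0 : parity_sum odd_part 0 0
| ParitySumWord (w : seq bool) x s c : odd (size w) = odd_part ->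
    parity_sum odd_part x s ->
    parity_sum odd_part (c *: (\prod_(i <- w) if i then a else b) + x) (c + s).

Lemma parity_sumD o x s y t :
  parity_sum o x s -> parity_sum o y t -> parity_sum o (x + y) (s + t).
Proof.
move=> xs yt; elim: xs => [|w {}x {}s c ow _ IH]; first by rewrite !add0r.
by rewrite -!addrA; constructor.
Qed.

Lemma parity_sumZ o x s c :
  parity_sum o x s -> parity_sum o (c *: x) (c * s).
Proof.
elim=> [|w {}x {}s e ow _ IH]; first by rewrite scaler0 mulr0; constructor.
by rewrite scalerDr scalerA mulrDr; constructor.
Qed.

Lemma parity_sumM o x s (i : bool) :
  parity_sum o x s -> parity_sum (~~ o) ((if i then a else b) * x) s.
Proof.
elim=> [|w {}x {}s c ow _ IH]; first by rewrite mulr0; constructor.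
rewrite mulrDr -scalerAr.
have := @ParitySumWord (~~ o) (i :: w) _ _ c _ IH; rewrite big_cons; apply.
by rewrite /= ow.
Qed.

Lemma odd_word (w : seq bool) : odd (size w) ->
  exists n, \prod_(i <- w) (if i then a else b) = (a * b) ^+ n * a \/
            \prod_(i <- w) (if i then a else b) = (b * a) ^+ n * b.
Proof.
have abba : a * b * (b * a) = 1 by rewrite mulrA -(mulrA a) bb mulr1 aa.
have baab : b * a * (a * b) = 1 by rewrite mulrA -(mulrA b) aa mulr1 bb.
have [m] := ubnP (size w); elim: m w => // m IH [//|x [|y w]] /= sw ow.
  by rewrite big_seq1; exists 0; rewrite !mul1r; case: x {sw ow}; [left|right].
rewrite negbK in ow.
have {IH} [|n IH] := IH w _ ow; first exact: ltnW.
rewrite !big_cons mulrA; case: x y {sw} => -[]; rewrite ?aa ?bb ?mul1r.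
- by exists n.
- case: IH => ->; first by exists n.+1; left; rewrite exprS !mulrA.
  case: n => [|n]; first by exists 0; left; rewrite !mul1r -mulrA bb mulr1.
  by exists n; right; rewrite exprS !mulrA -(mulrA (a * b)) abba mul1r.
- case: IH => ->; last by exists n.+1; right; rewrite exprS !mulrA.
  case: n => [|n]; first by exists 0; right; rewrite !mul1r -mulrA aa mulr1.
  by exists n; left; rewrite exprS !mulrA -(mulrA (b * a)) baab mul1r.
- by exists n.
Qed.

End SymmetryWords.

Lemma expr_flip (T : pzRingType) (x y : T) n : (x * y) ^+ n * x = x * (y * x) ^+ n.
Proof.
by elim: n => [|n IH]; rewrite ?mulr1 ?mul1r// !exprS -mulrA IH !mulrA.
Qed.

Section Trace.
Variables (F : numFieldType) (A : algType F) (tau : {scalar A}).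
Hypothesis trace : forall x y, tau (x * y) = tau (y * x).

Lemma trace_odd_word (a b : A) (k : F) n : a * a = 1 -> b * b = 1 ->
  tau a = k -> tau b = k -> tau ((a * b) ^+ n * a) = k.
Proof.
move=> aa bb ta tb.
have baab m : (b * a) ^+ m * (a * b) ^+ m = 1.
  elim: m => [|m IH]; first by rewrite mulr1.
  rewrite exprSr exprS mulrA -(mulrA _ (b * a)) (_ : b * a * (a * b) = 1) ?mulr1//.
  by rewrite mulrA -(mulrA b) aa mulr1 bb.
have conj m x : tau ((a * b) ^+ m * x * (b * a) ^+ m) = tau x.
  by rewrite trace mulrA baab mul1r.
rewrite -(odd_double_half n) -addnn addnCA !exprD -!mulrA expr_flip !mulrA.
rewrite -(mulrA _ _ a) conj; case: (odd n); last by rewrite mul1r.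
by rewrite trace mulrA aa mul1r.
Qed.


Lemma trace_parity_sum (a b : A) (k : F) x s : a * a = 1 -> b * b = 1 ->
  tau a = k -> tau b = k -> parity_sum a b true x s -> tau x = k * s.
Proof.
move=> aa bb ta tb; elim=> [|w {}x {}s c ow _ IH]; first by rewrite linear0 mulr0.
rewrite linearP/= IH mulrDr (mulrC k c); congr (c * _ + _).
by have [n [->|->]] := odd_word aa bb ow; apply: trace_odd_word.
Qed.

Lemma split_parity (a b : A) (k : F) n : a * a = 1 -> b * b = 1 ->
  exists X Y r t,
  [/\ parity_sum a b false X r /\ parity_sum a b true Y t,
      ((a + k%:A) * (b + k%:A)) ^+ n = X + Y,
      ((a - k%:A) * (b - k%:A)) ^+ n = X - Y,
      (1 + k) ^+ (2 * n) = r + t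
    & (1 - k) ^+ (2 * n) = r - t].
Proof.
move=> aa bb; elim: n => [|n [X [Y [r [t [[pX pY] Np Nm ep em]]]]]].
  exists 1, 0, 1, 0; rewrite !muln0 !expr0 !addr0 !subr0; split=> //; split.
    have := @ParitySumWord _ _ a b false [::] 0 0 1 erefl (ParitySum0 _ _ _).
    by rewrite big_nil scale1r !addr0.
  exact: ParitySum0.
pose ev x := a * (b * x) + (k * k) *: x.
pose od x := k *: (a * x) + k *: (b * x).
have evp i x s : parity_sum a b i x s -> parity_sum a b i (ev x) (s + k * k * s).
  move=> px; apply: parity_sumD; last exact: parity_sumZ.
  by have /parity_sumM := parity_sumM false px => /(_ true); rewrite negbK.
have odp i x s : parity_sum a b i x s -> parity_sum a b (~~ i) (od x) (k * s + k * s).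
  move=> px; apply: parity_sumD; apply: parity_sumZ.
    exact: (parity_sumM true px).
  exact: (parity_sumM false px).
have mulp l x : (a + l%:A) * (b + l%:A) * x =
    a * (b * x) + (l * l) *: x + (l *: (a * x) + l *: (b * x)).
  rewrite mulrDl !mulrDr !mulrDl -!scalerAl -!scalerAr !mul1r !mulr1 -!scalerAl.
  by rewrite mul1r scalerA mulrA (addrC (l *: (b * x))) addrACA.
have evD x y : ev (x + y) = ev x + ev y.
  by rewrite /ev !mulrDr scalerDr addrACA.
have odD x y : od (x + y) = od x + od y.
  by rewrite /od !mulrDr !scalerDr addrACA.
have evN x : ev (- x) = - ev x by rewrite /ev !mulrN scalerN opprD.
have odN x : od (- x) = - od x by rewrite /od !mulrN !scalerN opprD.
exists (ev X + od Y), (ev Y + od X), (r + k * k * r + (k * t + k * t)),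
  (t + k * k * t + (k * r + k * r)); split.
- split; apply: parity_sumD; do ?[exact: evp].
    exact: (odp true).
  exact: (odp false).
- rewrite exprS Np mulp -/(ev _) -/(od _) evD odD.
  by rewrite (addrC (od X)) addrACA.
- rewrite exprS Nm -scaleNr mulp mulrNN !scaleNr -opprD -/(ev _) -/(od _) evD odD evN odN.
  by rewrite (opprB (od X)) (opprD (ev Y)) addrACA.
- by rewrite mulnS exprD ep; ring.
- by rewrite mulnS exprD em; ring.
Qed.

Lemma trace_free_symmetries (a b : A) (k : F) n : a * a = 1 -> b * b = 1 ->
  tau a = k -> tau b = k ->
  (forall m, tau (((a - k%:A) * (b - k%:A)) ^+ m.+1) = 0) ->
  tau (((b + k%:A) * (a + k%:A)) ^+ n.+1) =
    k * ((1 + k) ^+ (2 * n.+1) - (1 - k) ^+ (2 * n.+1)).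
Proof.
move=> aa bb ta tb free.
have [X [Y [r [t [[_ pY] Np Nm ep em]]]]] := split_parity k n.+1 aa bb.
have -> : tau (((b + k%:A) * (a + k%:A)) ^+ n.+1) =
          tau (((a + k%:A) * (b + k%:A)) ^+ n.+1).
  by rewrite exprSr mulrA expr_flip trace mulrA -exprS.
have /eqP := free n; rewrite Np Nm ep em linearB linearD/= subr_eq0 => /eqP->.
by rewrite (trace_parity_sum aa bb ta tb pY); ring.
Qed.

Lemma trace_cheb_symmetries (a b x : A) (k : F) n : a * a = 1 -> b * b = 1 ->
  tau 1 = 1 -> tau a = k -> tau b = k ->
  (forall m, tau (((a - k%:A) * (b - k%:A)) ^+ m.+1) = 0) ->
  a * b + b * a = x *+ 2 ->
  tau (cheb (x + (k ^+ 2)%:A) ((1 - k ^+ 2) ^+ 2)%:A n) =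
    (n == 0)%:R + k * ((1 + k) ^+ (2 * n) - (1 - k) ^+ (2 * n)) / 2.
Proof.
move=> aa bb t1 ta tb free abx.
have two0 : (2 : F) != 0 by rewrite pnatr_eq0.
have sq1 (y : A) : y * y = 1 -> (y - k%:A) * (y + k%:A) = (1 - k ^+ 2)%:A.
  move=> yy; rewrite mulrDr !mulrBl yy -!scalerAl -!scalerAr !(mul1r, mulr1).
  by rewrite scalerA addrA subrK scalerBl scale1r expr2.
have sq2 (y : A) : y * y = 1 -> (y + k%:A) * (y - k%:A) = (1 - k ^+ 2)%:A.
  move=> yy; rewrite mulrBr !mulrDl yy -!scalerAl -!scalerAr !(mul1r, mulr1).
  by rewrite scalerA opprD addrA addrK scalerBl scale1r expr2.
have scl c (y z : A) : y * z = c%:A ->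
    forall p r : A, p * r = c%:A -> p * y * (z * r) = (c ^+ 2)%:A.
  by move=> yz p r pr; rewrite mulrA -(mulrA p) yz -scalerAr mulr1 -scalerAl pr scalerA.
have MN : (a - k%:A) * (b - k%:A) + (b + k%:A) * (a + k%:A) = (x + (k ^+ 2)%:A) *+ 2.
  rewrite mulrnDl -abx !(mulrDr, mulrDl, mulrN, mulNr) -!scalerAl -!scalerAr.
  rewrite !(mul1r, mulr1) scalerA opprK.
  rewrite (AC ((2*2)*(2*2))%AC (1*5*(2*7)*(3*6)*(4*8))%AC)/=.
  by rewrite !addNr !addr0 -mulr2n expr2.
have := cheb_pair n MN (scl _ _ _ (sq1 _ bb) _ _ (sq1 _ aa))
  (scl _ _ _ (sq2 _ aa) _ _ (sq2 _ bb)).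
move=> /(congr1 tau); rewrite linearMn linearD/=.
case: n => [|n]; first by rewrite !expr0 t1 subrr mulr0 mul0r addr0.
rewrite free add0r trace_free_symmetries//= add0r => ->.
by rewrite -[tau _ *+ 2]mulr_natr mulfK.
Qed.

End Trace.

(** * Determination of a measure on the circle by its moments *)

Section Signum.
Variable R : realType.
Implicit Types x : R.

(* An odd polynomial map of [-1, 1] with attracting fixed points -1 and 1: its
   iterates are polynomials converging boundedly to the sign function. *)
Definition smooth_step x : R := (3 * x - x ^+ 3) / 2.

Lemma smooth_step_itv x : -1 <= x <= 1 -> -1 <= smooth_step x <= 1.
Proof.
move=> /andP[x1 x2]; rewrite /smooth_step.
have : 0 <= (1 - x) ^+ 2 * (2 + x) by rewrite mulr_ge0 ?sqr_ge0//; lra.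
have : 0 <= (1 + x) ^+ 2 * (2 - x) by rewrite mulr_ge0 ?sqr_ge0//; lra.
by move=> h1 h2; apply/andP; split; lra.
Qed.

Lemma iter_smooth_step_itv n x : -1 <= x <= 1 -> -1 <= iter n smooth_step x <= 1.
Proof. by move=> x1; elim: n => //= n; exact: smooth_step_itv. Qed.

Lemma iter_smooth_stepN n x : iter n smooth_step (- x) = - iter n smooth_step x.
Proof. by elim: n => //= n ->; rewrite /smooth_step; field. Qed.

Lemma cvg_iter_smooth_step x : -1 <= x <= 1 ->
  iter n smooth_step x @[n --> \oo] --> Num.sg x.
Proof.
wlog x0 : x / 0 < x.
  move=> W x1; have [|xn|x0] := ltgtP 0 x; first by move/W; exact.
    have x0 : 0 < - x by rewrite oppr_gt0.
    have x1' : -1 <= - x <= 1 by rewrite lerNl opprK lerNl andbC.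
    have := W _ x0 x1'; rewrite sgrN => /cvgN; rewrite opprK.
    apply: cvg_trans; apply: near_eq_cvg.
    by apply: nearW => n; rewrite !fctE iter_smooth_stepN opprK.
  rewrite -x0 sgr0 (_ : (fun n => _) = cst 0); first exact: cvg_cst.
  by apply/funext => n; elim: n => //= n ->; rewrite /smooth_step/=; field.
move=> /andP[_ x1]; rewrite gtr0_sg//.
have bnd n : x <= iter n smooth_step x <= 1 /\
    1 - (1 - x / 2) ^+ n <= iter n smooth_step x.
  elim: n => [|n /=]; first by rewrite /= expr0 subrr lexx x1 ltW.
  set y := iter n _ x => -[/andP[xy y1] IH]; rewrite /smooth_step; split.
    have : 0 <= (1 - y) ^+ 2 * (2 + y) by rewrite mulr_ge0 ?sqr_ge0//; lra.
    have : 0 <= y * (1 - y) * (1 + y) by rewrite !mulr_ge0//; lra.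
    by move=> h1 h2; apply/andP; split; lra.
  have h1 : 0 <= (1 - y) * (y - x + y ^+ 2).
    by apply: mulr_ge0; [lra|have := sqr_ge0 y; lra].
  have h2 : 0 <= ((1 - x / 2) ^+ n - (1 - y)) * (1 - x / 2).
    by rewrite mulr_ge0//; lra.
  by rewrite exprSr; lra.
apply: (@squeeze_cvgr _ _ _ _ (fun n => 1 - (1 - x / 2) ^+ n) (cst 1)).
- by apply: nearW => n; have [/andP[_ ->] ->] := bnd n.
- rewrite -[X in _ --> X]subr0; apply: cvgB; first exact: cvg_cst.
  by apply: cvg_expr; rewrite ger0_norm; lra.
- exact: cvg_cst.
Qed.

End Signum.

Section Circle.
Variable R : realType.
Implicit Types z : circle R.

Definition re z : R := complex.Re (circle_val z).
Definition im z : R := complex.Im (circle_val z).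

Lemma circle_sqr z : re z ^+ 2 + im z ^+ 2 = 1.
Proof.
rewrite /re /im; case: z => -[x y] /= /eqP; rewrite normc_def/=.
move=> -[/(congr1 (fun t => t ^+ 2))].
by rewrite sqr_sqrtr ?addr_ge0 ?sqr_ge0// expr1n.
Qed.

Lemma re_itv z : -1 <= re z <= 1.
Proof. by have := circle_sqr z => ?; apply/andP; split; nra. Qed.

Lemma im_itv z : -1 <= im z <= 1.
Proof. by have := circle_sqr z => ?; apply/andP; split; nra. Qed.

Lemma measurable_circle_coord : measurable_fun setT (@circle_coord R).
Proof. by move=> _ B mB; rewrite setTI; exists B; rewrite ?setTI. Qed.

Lemma measurable_re : measurable_fun setT re.
Proof. exact: (measurableT_comp measurable_fst measurable_circle_coord). Qed.

Lemma measurable_im : measurable_fun setT im.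
Proof. exact: (measurableT_comp measurable_snd measurable_circle_coord). Qed.

Lemma measurable_horner (p : {poly R}) : measurable_fun setT (horner p).
Proof. by apply: continuous_measurable_fun => x; exact: continuous_horner. Qed.

(* As [im z ^+ 2 = 1 - re z ^+ 2], this class is stable under products. *)
Definition trig (f : circle R -> R) :=
  exists p q : {poly R}, forall z, f z = p.[re z] + im z * q.[re z].

Lemma trig_cst c : trig (cst c).
Proof. by exists c%:P, 0 => z; rewrite hornerC horner0 mulr0 addr0. Qed.

Lemma trig_re : trig re.
Proof. by exists 'X, 0 => z; rewrite hornerX horner0 mulr0 addr0. Qed.

Lemma trig_im : trig im.
Proof. by exists 0, 1 => z; rewrite horner0 hornerC mulr1 add0r. Qed.

Lemma trigD f g : trig f -> trig g -> trig (f \+ g).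
Proof.
move=> [p [q fE]] [p' [q' gE]]; exists (p + p'), (q + q') => z /=.
by rewrite fE gE !hornerD; ring.
Qed.

Lemma trigM f g : trig f -> trig g -> trig (f \* g).
Proof.
move=> [p [q fE]] [p' [q' gE]].
exists (p * p' + (1 - 'X^2) * q * q'), (p * q' + q * p') => z /=.
rewrite fE gE !hornerE.
have -> : 1 - re z ^+ 2 = im z ^+ 2 by rewrite -(circle_sqr z) addrAC subrr add0r.
by ring.
Qed.

Lemma trigZ c f : trig f -> trig (fun z => c * f z).
Proof. by move=> tf; exact: (trigM (trig_cst c) tf). Qed.

Lemma measurable_trig f : trig f -> measurable_fun setT f.
Proof.
move=> [p [q /funext ->]]; apply: measurable_funD.
  exact: (measurableT_comp (measurable_horner p) measurable_re).
apply: measurable_funM; first exact: measurable_im.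
exact: (measurableT_comp (measurable_horner q) measurable_re).
Qed.

Lemma norm_horner_le (p : {poly R}) x : `|x| <= 1 ->
  `|p.[x]| <= \sum_(i < size p) `|p`_i|.
Proof.
move=> x1; rewrite horner_coef (le_trans (ler_norm_sum _ _ _))// ler_sum// => i _.
by rewrite normrM normrX ler_piMr// exprn_ile1.
Qed.

Lemma trig_bounded f : trig f -> exists M, forall z, `|f z| <= M.
Proof.
move=> [p [q fE]].
exists (\sum_(i < size p) `|p`_i| + \sum_(i < size q) `|q`_i|) => z.
have re1 : `|re z| <= 1 by rewrite ler_norml re_itv.
have im1 : `|im z| <= 1 by rewrite ler_norml im_itv.
rewrite fE (le_trans (ler_normD _ _))// lerD ?norm_horner_le// normrM.
by rewrite (le_trans (ler_piMl _ im1))// norm_horner_le.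
Qed.

Lemma trig_integrable (mu : {finite_measure set circle R -> \bar R}) 
    (f g : circle R -> R) : trig f ->
  measurable_fun setT g -> (forall z, `|g z| <= 1) ->
  mu.-integrable setT (fun z => (f z * g z)%:E).
Proof.
move=> tf mg g1; apply: measurable_bounded_integrable => //.
- exact: fin_num_fun_lty.
- by apply: measurable_funM => //; exact: measurable_trig.
- have [M fM] := trig_bounded tf; exists M; split; first exact: num_real.
  move=> y My z _ /=; rewrite normrM (le_trans (ler_piMr _ (g1 z)))//.
  by rewrite (le_trans (fM z))// ltW.
Qed.

Lemma trig_iter_smooth_step n f : trig f -> trig (iter n (@smooth_step R) \o f).
Proof.
move=> tf; elim: n => [//|n IH]; rewrite (_ : _ \o _ =
  (fun z => 2^-1 * ((fun z => 3 * (iter n (@smooth_step R) \o f) z) \+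
     (fun z => (-1) * ((iter n (@smooth_step R) \o f) \*
       ((iter n (@smooth_step R) \o f) \* (iter n (@smooth_step R) \o f))) z)) z)).
  apply/trigZ/trigD; first exact: trigZ.
  by apply/trigZ/trigM => //; exact: trigM.
by apply/funext => z /=; rewrite {1}/smooth_step; field.
Qed.

Definition quadrant a b : set (circle R) := [set z | a < re z /\ b < im z].

Lemma measurable_quadrant a b : measurable (quadrant a b).
Proof.
have mr : measurable (re @^-1` `]a, +oo[%classic).
  by rewrite -[X in measurable X]setTI; exact: measurable_re.
have mi : measurable (im @^-1` `]b, +oo[%classic).
  by rewrite -[X in measurable X]setTI; exact: measurable_im.
rewrite (_ : quadrant a b =
  re @^-1` `]a, +oo[%classic `&` im @^-1` `]b, +oo[%classic).
  exact: measurableI.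
by apply/seteqP; split => z; rewrite /quadrant /= !in_itv /= !andbT.
Qed.

Lemma quadrantI a b a' b' :
  quadrant a b `&` quadrant a' b' = quadrant (Num.max a a') (Num.max b b').
Proof.
apply/seteqP; split => z; rewrite /quadrant /= !gt_max.
  by move=> [[-> ->] [-> ->]].
by move=> [/andP[-> ->] /andP[-> ->]].
Qed.

Lemma quadrantT : quadrant (-2) (-2) = setT.
Proof.
apply/seteqP; split => z // _; have /andP[? _] := re_itv z.
by have /andP[? _] := im_itv z; split; lra.
Qed.

Lemma measurable_circleE :
  @measurable _ (circle R) = <<s [set quadrant ab.1 ab.2 | ab in [set: R * R]] >>.
Proof.
apply/seteqP; split; last first.
  apply: smallest_sub; first exact: sigma_algebra_measurable.
  by move=> _ [ab _ <-]; exact: measurable_quadrant.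
set G := [set _ | _ in _].
have mre : measurable_fun setT (re : g_sigma_algebraType G -> R).
  apply: (measurability _ (RGenOInfty.measurableE R)) => _ [_ [x ->] <-].
  apply: sub_sigma_algebra; exists (x, -2) => //.
  apply/seteqP; split => z; rewrite /quadrant /= !in_itv /= andbT; first by move=> [].
  by move=> [_ ?]; split => //; have /andP[? _] := im_itv z; lra.
have mim : measurable_fun setT (im : g_sigma_algebraType G -> R).
  apply: (measurability _ (RGenOInfty.measurableE R)) => _ [_ [x ->] <-].
  apply: sub_sigma_algebra; exists (-2, x) => //.
  apply/seteqP; split => z; rewrite /quadrant /= !in_itv /= andbT; first by move=> [].
  by move=> [_ ?]; split => //; have /andP[? _] := re_itv z; lra.
have mc := measurable_fun_pair mre mim.
by move=> _ [B mB <-]; exact: mc.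
Qed.

Lemma quadrant_approx a b : exists f_ : nat -> circle R -> R,
  [/\ forall n, trig (f_ n), forall n z, `|f_ n z| <= 1
    & forall z, f_ n z @[n --> \oo] --> (\1_(quadrant a b) z : R)].
Proof.
pose h n (y : R) := (iter n (@smooth_step R) y + iter n (@smooth_step R) y ^+ 2) / 2.
have h1 n y : -1 <= y <= 1 -> `|h n y| <= 1.
  by move=> /(iter_smooth_step_itv n) ?; rewrite ler_norml /h; apply/andP; split; nra.
have hlim y : -1 <= y <= 1 -> h n y @[n --> \oo] --> ((0 < y)%R%:R : R).
  move=> /cvg_iter_smooth_step ylim.
  rewrite (_ : (0 < y)%R%:R = (Num.sg y + Num.sg y ^+ 2) / 2); last first.
    have [y0|y0|<-] := ltgtP 0 y.
    - by rewrite gtr0_sg// expr1n -[1 + 1]/(2%:R) divff.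
    - by rewrite ltr0_sg// sqrrN expr1n addNr mul0r.
    - by rewrite sgr0 expr0n addr0 mul0r.
  by apply: cvgM; [apply: cvgD => //; rewrite expr2; exact: cvgM|exact: cvg_cst].
have htrig n (f : circle R -> R) : trig f -> trig (h n \o f).
  move=> tf; rewrite (_ : _ \o _ = (fun z => 2^-1 * ((iter n (@smooth_step R) \o f) \+
    ((iter n (@smooth_step R) \o f) \* (iter n (@smooth_step R) \o f))) z)).
    by apply: trigZ; apply: trigD; [|apply: trigM]; exact: trig_iter_smooth_step.
  by apply/funext => z /=; rewrite /h mulrC expr2.
pose sc (c t : R) := (1 + `|c|)^-1 * (t - c).
have sc_gt0 c : 0 < (1 + `|c|)^-1 by rewrite invr_gt0 ltr_pwDl.
have sc_itv c t : -1 <= t <= 1 -> -1 <= sc c t <= 1.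
  rewrite -!ler_norml => t1; rewrite /sc normrM gtr0_norm// mulrC.
  rewrite ler_pdivrMr ?ltr_pwDl// mul1r.
  by rewrite (le_trans (ler_normB _ _))// lerD2r.
have sc_trig c (f : circle R -> R) : trig f -> trig (sc c \o f).
  move=> tf; apply: (@trigZ _ (f \+ cst (- c))).
  by apply: trigD => //; exact: trig_cst.
exists (fun n => (h n \o (sc a \o re)) \* (h n \o (sc b \o im))); split.
- move=> n; apply: trigM; apply: htrig; apply: sc_trig; [exact: trig_re|exact: trig_im].
- move=> n z; rewrite normrM mulr_ile1// h1// sc_itv//; [exact: re_itv|exact: im_itv].
move=> z; rewrite (_ : \1_ _ z = (0 < sc a (re z))%R%:R * (0 < sc b (im z))%R%:R).
  by apply: cvgM; apply: hlim; apply: sc_itv; [exact: re_itv|exact: im_itv].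
rewrite /sc !pmulr_rgt0// !subr_gt0 indicE -natrM mulnb; congr (nat_of_bool _)%:R.
by apply/idP/idP => [/set_mem[-> ->]//|/andP[? ?]]; exact: mem_set.
Qed.

Lemma cvg_Rintegral (mu : {finite_measure set circle R -> \bar R})
    (f_ : nat -> circle R -> R) (f g : circle R -> R) :
  (forall n, trig (f_ n)) -> (forall n z, `|f_ n z| <= 1) ->
  (forall z, f_ n z @[n --> \oo] --> f z) ->
  measurable_fun setT f ->
  measurable_fun setT g -> (forall z, 0 <= g z <= 1) ->
  \int[mu]_z (f_ n z * g z) @[n --> \oo] --> \int[mu]_z (f z * g z).
Proof.
move=> tf f1 fl mf mg g01.
have mfg n : measurable_fun setT (fun z => (f_ n z * g z)%:E).
  by apply/measurable_EFinP/measurable_funM => //; exact: measurable_trig.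
have mfg' : measurable_fun setT (fun z => (f z * g z)%:E).
  exact/measurable_EFinP/measurable_funM.
have i1 : mu.-integrable setT (cst 1%E).
  by apply: finite_measure_integrable_cst.
have [||intf _ cv] := dominated_convergence measurableT mfg mfg' _ i1 _.
- apply: aeW => z _; apply: cvg_EFin; first exact: nearW.
  by apply: cvgM; [exact: fl|exact: cvg_cst].
- apply: aeW => z n _; rewrite /= lee_fin normrM mulr_ile1//.
  by have /andP[? ?] := g01 z; rewrite ger0_norm.
by apply: fine_cvg; rewrite fineK//; exact: integrable_fin_num.
Qed.

Lemma circle_measure_unique (mu lambda : {finite_measure set circle R -> \bar R})
    (k : {nonneg R}) (g : circle R -> R) :
  measurable_fun setT g -> (forall z, 0 <= g z <= 1) ->
  (forall f, trig f -> \int[mu]_z f z =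
    k%:num * f (circle_one R) + \int[lambda]_z (f z * g z)) ->
  forall B, measurable B -> mu B =
    (k%:num%:E * \d_(circle_one R) B + \int[lambda]_(z in B) (g z)%:E)%E.
Proof.
move=> mg g01 mom.
have g0 z : (0 <= (g z)%:E)%E by rewrite lee_fin; case/andP: (g01 z).
have mEg : measurable_fun setT (EFin \o g) by exact/measurable_EFinP.
pose dens (B : set (circle R)) := (\int[lambda]_(z in B) (g z)%:E)%E.
have dens_ge0 B : (0 <= dens B)%E by exact: integral_ge0.
pose densM := isMeasure.Build _ _ _ dens (integral_set0 _ _) dens_ge0
   (semi_sigma_additive_nng_induced mEg g0).
pose dens' : {measure set circle R -> \bar R} := HB.pack dens densM.
pose nu := measure_add (mscale k \d_(circle_one R)) dens'.
have nuE B : nu B = (k%:num%:E * \d_(circle_one R) B + dens B)%E.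
  by rewrite /nu /measure_add/= /msum !big_ord_recl big_ord0 adde0.
move=> B mB; rewrite -/(dens B) -nuE.
apply: (measure_unique [set quadrant ab.1 ab.2 | ab in [set: R * R]]
   (fun=> setT) measurable_circleE) => //.
- move=> _ _ [[a b] _ <-] [[a' b'] _ <-].
  by exists (Num.max a a', Num.max b b') => //=; rewrite quadrantI.
- by move=> _; exists (-2, -2) => //=; exact: quadrantT.
- by rewrite bigcup_const.
- move=> _ [[a b] _ <-] /=.
  have [f_ [tf f1 fl]] := quadrant_approx a b.
  have mQ := measurable_quadrant a b.
  have mi : measurable_fun setT (\1_(quadrant a b) : circle R -> R).
    exact: measurable_indic.
  have muQ : \int[mu]_z f_ n z @[n --> \oo] --> \int[mu]_z (\1_(quadrant a b) z).
    have h01 (z : circle R) : 0 <= cst (1 : R) z <= 1 by rewrite ler01 lexx.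
    have := @cvg_Rintegral mu _ _ (cst (1 : R)) tf f1 fl mi
      (measurable_cst (1 : R)) h01.
    rewrite (_ : (fun n => _) = (fun n => \int[mu]_z f_ n z)); last first.
      by apply/funext => n; apply: eq_Rintegral => z _; rewrite mulr1.
    rewrite (_ : \int[mu]_z (\1_(quadrant a b) z * cst 1 z) =
      \int[mu]_z (\1_(quadrant a b) z))//.
    by apply: eq_Rintegral => z _; rewrite mulr1.
  have laQ : k%:num * f_ n (circle_one R) + \int[lambda]_z (f_ n z * g z)
      @[n --> \oo] --> k%:num * \1_(quadrant a b) (circle_one R) +
                       \int[lambda]_z (\1_(quadrant a b) z * g z).
    apply: cvgD; last exact: cvg_Rintegral.
    by apply: cvgM; [exact: cvg_cst|exact: fl].
  have eqQ : \int[mu]_z (\1_(quadrant a b) z) =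
      k%:num * \1_(quadrant a b) (circle_one R) +
      \int[lambda]_z (\1_(quadrant a b) z * g z).
    rewrite -(cvg_lim (@Rhausdorff R) muQ); apply: cvg_lim => //.
    apply: cvg_trans laQ; apply: near_eq_cvg.
    by apply: nearW => n; rewrite mom.
  rewrite [RHS]nuE /dens diracE -indicE.
  have -> : mu (quadrant a b) = (\int[mu]_z (\1_(quadrant a b) z))%:E.
    rewrite /Rintegral fineK; first by rewrite integral_indic ?setIT.
    by rewrite integral_indic ?setIT ?fin_num_measure.
  rewrite eqQ EFinD EFinM; congr (_ + _)%E.
  rewrite integral_mkcond /Rintegral fineK; last first.
    apply: integrable_fin_num => //.
    apply: measurable_bounded_integrable => //.
    - exact: fin_num_fun_lty.
    - exact: measurable_funM.
    - exists 1; split; first exact: num_real.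
      move=> y y1 z _ /=; rewrite (le_trans _ (ltW y1))// normrM mulr_ile1//.
        by rewrite indicE normr_nat lern1 leq_b1.
      by have /andP[? ?] := g01 z; rewrite ger0_norm.
  apply: eq_integral => z _; rewrite patchE indicE.
  by case: ifPn => _; rewrite ?mul1r ?mul0r.
- by move=> _; rewrite fin_num_fun_lty.
Qed.

End Circle.

(** * The Haar measure as an image of uniform distributions *)

Section Integrals.
Variable R : realType.
Notation mu := (@lebesgue_measure R).

Lemma Rintegral_FTC (f F : R -> R) (a b : R) : a < b -> continuous f ->
  (forall x : R, is_derive x 1 F (f x)) -> \int[mu]_(x in `[a, b]) f x = F b - F a.
Proof.
move=> ab cf dF.
have cF : continuous F.
  move=> x; apply: differentiable_continuous; apply/derivable1_diffP.
  by have := dF x => -[].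
rewrite /Rintegral (@continuous_FTC2 _ f F)//.
- exact: continuous_subspaceT.
- split.
  + by move=> x _; have := dF x => -[].
  + exact/cvg_at_right_filter/cF.
  + exact/cvg_at_left_filter/cF.
- by move=> x _; rewrite derive1E; have := dF x => -[].
Qed.

Lemma Rintegral_cosM (m a b : R) : a < b -> m != 0 ->
  \int[mu]_(t in `[a, b]) cos (m * t) = (sin (m * b) - sin (m * a)) / m.
Proof.
move=> ab m0.
have dF (x : R) : is_derive x 1 (fun t => sin (m * t) / m) (cos (m * x)).
  apply: is_derive_eq.
  by rewrite /GRing.scale/=; field.
rewrite (Rintegral_FTC ab _ dF) -?mulrBl// => x.
by apply: continuous_comp; [exact: mulrl_continuous|exact: continuous_cos].
Qed.

Lemma Rintegral_uniform (a b : R) (ab : a < b) (f : R -> R) :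
  measurable_fun setT f -> (exists M, forall x, `|f x| <= M) ->
  \int[uniform_prob ab]_x f x = (b - a)^-1 * \int[mu]_(x in `[a, b]) f x.
Proof.
move=> mf [M fM].
have M0 : 0 <= M by apply: le_trans (fM 0).
have bi (m : {measure set (measurableTypeR R) -> \bar R}) A (c : R) :
    measurable A -> (m A < +oo)%E ->
    m.-integrable A (fun x => (f x + c)%:E).
  move=> mA finm; apply: measurable_bounded_integrable => //.
    by apply: measurable_funTS; exact: measurable_funD.
  exists (M + `|c|); split; first exact: num_real.
  move=> y My z _ /=; rewrite (le_trans (ler_normD _ _))//.
  by rewrite (le_trans _ (ltW My))// lerD2r.
have muab : mu `[a, b] = (b - a)%:E by rewrite lebesgue_measure_itv/= lte_fin ab.
have muoo : (mu `[a, b] < +oo)%E by rewrite muab ltry.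
have unoo : (uniform_prob ab setT < +oo)%E by rewrite fin_num_fun_lty.
have bi0 (m : {measure set (measurableTypeR R) -> \bar R}) A :
    measurable A -> (m A < +oo)%E ->
    m.-integrable A (EFin \o f).
  by move=> mA finm; have := bi m A 0 mA finm; under eq_fun do rewrite addr0.
have : \int[uniform_prob ab]_x (f x + M) =
    (b - a)^-1 * \int[mu]_(x in `[a, b]) (f x + M).
  rewrite /Rintegral (@integral_uniform _ _ _ ab (fun x => (f x + M)%:E)).
  - by rewrite fineM//; apply: integrable_fin_num => //; exact: bi.
  - by apply/measurable_EFinP/measurable_funD.
  - by move=> x; rewrite lee_fin; have := fM x; rewrite ler_norml; lra.
rewrite RintegralD//; [|exact: bi0|exact: finite_measure_integrable_cst].
rewrite RintegralD//; [|exact: bi0|]; last first.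
  by apply: measurable_bounded_integrable => //; exact: bounded_cst.
rewrite !Rintegral_cst// [fine (lebesgue_measure _)](_ : _ = b - a); last first.
  by rewrite lebesgue_measure_itv/= lte_fin ab.
rewrite [fine (uniform_prob _ _)](_ : _ = 1); last by rewrite probability_setT.
have : b - a != 0 by rewrite gt_eqF// subr_gt0.
by move=> ba0; rewrite mulr1 mulrDr mulrCA mulVf// mulr1 => /addIr.
Qed.

End Integrals.

Section Haar.
Variable R : realType.
Implicit Types z : circle R.

Lemma measurable_circle_fun d (T : measurableType d) (f : T -> circle R) :
  measurable_fun setT (@re R \o f) -> measurable_fun setT (@im R \o f) ->
  measurable_fun setT f.
Proof.
move=> mr mi _ _ [B mB <-]; have := measurable_fun_pair mr mi.
by move=> /(_ measurableT _ mB); rewrite !setTI.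
Qed.

Definition circle_expM (k t : R) : circle R := circle_exp (k * t).

Lemma measurable_circle_expM (k : R) : measurable_fun setT (circle_expM k).
Proof.
apply: measurable_circle_fun; apply: continuous_measurable_fun => x;
  (apply: continuous_comp; [exact: mulrl_continuous|]).
  exact: continuous_cos.
exact: continuous_sin.
Qed.

Definition exp_uniform (a b : R) (ab : a < b) (k : R) : probability (circle R) R :=
  distribution (uniform_prob ab)
    (@mfun_Sub _ _ (measurableTypeR R) (circle R) (circle_expM k)
       (mem_set (measurable_circle_expM k))).

Lemma re_exp t : re (circle_exp t) = cos t :> R. Proof. by []. Qed.
Lemma im_exp t : im (circle_exp t) = sin t :> R. Proof. by []. Qed.

Lemma Rintegral_exp_uniform (a b : R) (ab : a < b) k (f : circle R -> R) :
  measurable_fun setT f -> (exists M, forall z, `|f z| <= M) ->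
  \int[exp_uniform ab k]_z f z =
  (b - a)^-1 * \int[lebesgue_measure]_(t in `[a, b]) f (circle_expM k t).
Proof.
move=> mf [M fM].
rewrite -(@Rintegral_uniform _ _ _ ab (fun t => f (circle_expM k t))).
- rewrite /Rintegral; congr fine; apply: integral_pushforward => //.
  + exact/measurable_EFinP.
  + apply: measurable_bounded_integrable => //.
    * by rewrite preimage_setT; exact: measurableT.
    * apply: le_lt_trans (ltry 1); apply: probability_le1.
      by rewrite preimage_setT; exact: measurableT.
    * rewrite preimage_setT; apply: (measurableT_comp mf).
      exact: measurable_circle_expM.
    * exists M; split; first exact: num_real.
      by move=> y My z _ /=; rewrite (le_trans (fM _))// ltW.
- by apply: measurableT_comp => //; exact: measurable_circle_expM.
- by exists M => x; exact: fM.
Qed.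

Lemma Rintegral_trigP (mu : {finite_measure set circle R -> \bar R})
    (h f g : circle R -> R) (c : R) :
  measurable_fun setT h -> (forall z, `|h z| <= 1) -> trig f -> trig g ->
  \int[mu]_z ((c * f z + g z) * h z) =
  c * \int[mu]_z (f z * h z) + \int[mu]_z (g z * h z).
Proof.
move=> mh h1 tf tg; under eq_Rintegral do rewrite mulrDl -mulrA.
rewrite RintegralD//; last exact: trig_integrable.
  by rewrite RintegralZl//; exact: trig_integrable.
by under eq_fun do rewrite mulrA; apply: trig_integrable => //; exact: trigZ.
Qed.

Lemma Rintegral_trig_linear (mu : {finite_measure set circle R -> \bar R})
    (f g : circle R -> R) (c : R) : trig f -> trig g ->
  \int[mu]_z (c * f z + g z) = c * \int[mu]_z f z + \int[mu]_z g z.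
Proof.
move=> tf tg; have h1 (z : circle R) : `|cst (1 : R) z| <= 1 by rewrite normr1.
have := @Rintegral_trigP mu (cst 1) _ _ c (measurable_cst (1 : R)) h1 tf tg.
have e F : \int[mu]_z (F z * cst 1 z) = \int[mu]_z F z.
  by apply: eq_Rintegral => z _; rewrite mulr1.
by rewrite !e.
Qed.

Lemma trig_horner_re (p : {poly R}) : trig (fun z => p.[re z]).
Proof. by exists p, 0 => z; rewrite horner0 mulr0 addr0. Qed.

Lemma trig_im_horner_re (p : {poly R}) : trig (fun z => im z * p.[re z]).
Proof. by exists 0, p => z; rewrite horner0 add0r. Qed.

Definition chebT (n : nat) : {poly R} := cheb 'X 1 n.

Lemma size_chebT n : size (chebT n) = n.+1.
Proof. by rewrite /chebT -[X in cheb X _]addr0 -(size_cheb (0 : R) 1 n) polyC0. Qed.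

Lemma horner_chebT n x : (chebT n).[x] = cheb x 1 n.
Proof.
by rewrite -[LHS]/(horner_eval x _) rmorph_cheb/= /horner_eval hornerX hornerC.
Qed.

Lemma chebT_cos n t : (chebT n).[cos t] = cos (n%:R * t).
Proof.
rewrite horner_chebT; elim/nat_ind2: n => [||n IH0 IH1].
- by rewrite mul0r cos0.
- by rewrite mul1r.
rewrite cheb_rec IH0 IH1 mul1r.
have -> : n.+2%:R * t = n.+1%:R * t + t by rewrite -[n.+2]addn1 natrD mulrDl mul1r.
have -> : n%:R * t = n.+1%:R * t - t by rewrite -[n.+1]addn1 natrD mulrDl mul1r addrK.
by rewrite cosB cosD; ring.
Qed.

Lemma circle_prob_unique (mu nu : probability (circle R) R) :
  (forall n, \int[mu]_z (chebT n).[re z] = \int[nu]_z (chebT n).[re z]) ->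
  (forall n, \int[mu]_z (im z * (chebT n).[re z]) =
             \int[nu]_z (im z * (chebT n).[re z])) ->
  forall B, measurable B -> mu B = nu B.
Proof.
move=> mre mim B mB.
have h01 (z : circle R) : 0 <= cst (1 : R) z <= 1 by rewrite ler01 lexx.
have mc : measurable_fun setT (cst (1 : R) : circle R -> R) by exact: measurable_cst.
have lin (m : probability (circle R) R) := @Rintegral_trig_linear m.
have Are (p : {poly R}) : \int[mu]_z p.[re z] = \int[nu]_z p.[re z].
  move: p; apply: (poly_graded_ind size_chebT) => // [|c p q IHp IHq].
    under eq_Rintegral do rewrite horner0.
    under [in RHS]eq_Rintegral do rewrite horner0.
    by rewrite !Rintegral_cst// !mul0r.
  under eq_Rintegral do rewrite hornerD hornerZ.
  under [in RHS]eq_Rintegral do rewrite hornerD hornerZ.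
  by rewrite !lin ?IHp ?IHq//; exact: trig_horner_re.
have Aim (p : {poly R}) : \int[mu]_z (im z * p.[re z]) = \int[nu]_z (im z * p.[re z]).
  move: p; apply: (poly_graded_ind size_chebT) => // [|c p q IHp IHq].
    under eq_Rintegral do rewrite horner0 mulr0.
    under [in RHS]eq_Rintegral do rewrite horner0 mulr0.
    by rewrite !Rintegral_cst// !mul0r.
  under eq_Rintegral do rewrite hornerD hornerZ mulrDr mulrCA.
  under [in RHS]eq_Rintegral do rewrite hornerD hornerZ mulrDr mulrCA.
  by rewrite !lin ?IHp ?IHq//; exact: trig_im_horner_re.
rewrite (@circle_measure_unique R mu nu 0%:nng _ mc h01 _ B mB).
  by rewrite mul0e add0e [LHS](integral_cst nu mB 1%E) mul1e.
move=> f [p [q /funext->]]; rewrite mul0r add0r.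
under [in RHS]eq_Rintegral do rewrite mulr1.
have := @lin mu _ _ 1 (trig_horner_re p) (trig_im_horner_re q).
have := @lin nu _ _ 1 (trig_horner_re p) (trig_im_horner_re q).
under eq_Rintegral do rewrite mul1r.
by move=> -> ; under eq_Rintegral do rewrite mul1r; move=> ->; rewrite Are Aim.
Qed.

Lemma Rintegral_sinM (m a b : R) : a < b -> cos (m * b) = cos (m * a) ->
  \int[lebesgue_measure]_(t in `[a, b]) sin (m * t) = 0.
Proof.
move=> ab cab; have [->|m0] := eqVneq m 0.
  by under eq_Rintegral do rewrite mul0r sin0; rewrite Rintegral_cst ?mul0r.
have dF (x : R) : is_derive x 1 (fun t => - (cos (m * t) / m)) (sin (m * x)).
  by apply: is_derive_eq; rewrite /GRing.scale/=; field.
rewrite (Rintegral_FTC ab _ dF) ?cab ?subrr// => x.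
by apply: continuous_comp; [exact: mulrl_continuous|exact: continuous_sin].
Qed.

Section ExpUniform.
Variables (a b k : R) (ab : a < b).
Hypotheses (k0 : k != 0).
Hypotheses (kcos : forall n, cos (n%:R * (k * b)) = cos (n%:R * (k * a))).
Hypotheses (ksin : forall n, sin (n%:R * (k * b)) = sin (n%:R * (k * a))).

Lemma exp_uniform_re n : \int[exp_uniform ab k]_z (chebT n).[re z] = (n == 0)%:R.
Proof.
rewrite Rintegral_exp_uniform; last 2 first.
  exact: measurable_trig (trig_horner_re _).
  exact: trig_bounded (trig_horner_re _).
under eq_Rintegral do rewrite /circle_expM re_exp chebT_cos mulrA.
case: n => [|n].
  under eq_Rintegral do rewrite !mul0r cos0.
  rewrite Rintegral_cst//= [fine (lebesgue_measure _)](_ : _ = b - a); last first.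
    by rewrite lebesgue_measure_itv/= lte_fin ab.
  by rewrite mul1r mulVf// gt_eqF// subr_gt0.
by rewrite Rintegral_cosM ?mulf_neq0 ?pnatr_eq0// -!mulrA ksin subrr mul0r mulr0.
Qed.

Lemma exp_uniform_im n : \int[exp_uniform ab k]_z (im z * (chebT n).[re z]) = 0.
Proof.
rewrite Rintegral_exp_uniform; last 2 first.
  exact: measurable_trig (trig_im_horner_re _).
  exact: trig_bounded (trig_im_horner_re _).
under eq_Rintegral do rewrite /circle_expM re_exp im_exp chebT_cos.
have E t : sin (k * t) * cos (n%:R * (k * t)) =
    2^-1 * (sin ((n%:R + 1) * k * t) + sin ((1 - n%:R) * k * t)).
  by rewrite -!mulrA !mulrDl mulNr !mul1r sinB sinD; field.
under eq_Rintegral do rewrite E.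
have cn (m : R) : continuous (fun t : R => sin (m * t)).
  by move=> x; apply: continuous_comp; [exact: mulrl_continuous|exact: continuous_sin].
have ii (m : R) :
    lebesgue_measure.-integrable `[a, b] (EFin \o (fun t : R => sin (m * t))).
  apply: continuous_compact_integrable; first exact: segment_compact.
  exact: continuous_subspaceT.
rewrite RintegralZl//; last first.
  have := integrableD _ (ii ((n%:R + 1) * k)) (ii ((1 - n%:R) * k)).
  by apply.
rewrite RintegralD// !Rintegral_sinM ?addr0 ?mulr0// -!mulrA -?natr1.
  case: n {E} => [|n]; first by have := kcos 1; rewrite subr0.
  by rewrite -natr1 opprD addrCA subrr addr0 !mulNr !cosN.
by rewrite natr1.
Qed.
End ExpUniform.

Lemma cos_2pi_mul n : cos (n%:R * (2 * pi)) = 1 :> R.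
Proof.
elim: n => [|n IH]; first by rewrite mul0r cos0.
by rewrite -natr1 mulrDl mul1r [X in _ + X]mulr_natl cosD2pi.
Qed.

Lemma sin_2pi_mul n : sin (n%:R * (2 * pi)) = 0 :> R.
Proof.
elim: n => [|n IH]; first by rewrite mul0r sin0.
by rewrite -natr1 mulrDl mul1r [X in _ + X]mulr_natl sinD2pi.
Qed.

End Haar.

(** * Moments of the spectral density *)

Section Poisson.
Variable R : realType.
Notation leb := (@lebesgue_measure R).

Lemma continuous_itv_integrable (a b : R) (f : R -> R) : continuous f ->
  leb.-integrable `[a, b] (EFin \o f).
Proof.
move=> cf; apply: continuous_compact_integrable; first exact: segment_compact.
exact: continuous_subspaceT.
Qed.

Lemma Rintegral_itvP (a b c d : R) (f g : R -> R) : continuous f -> continuous g ->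
  \int[leb]_(x in `[a, b]) (c * f x + d * g x) =
  c * \int[leb]_(x in `[a, b]) f x + d * \int[leb]_(x in `[a, b]) g x.
Proof.
move=> cf cg; rewrite RintegralD//.
- by rewrite !RintegralZl//; exact: continuous_itv_integrable.
- apply: (@continuous_itv_integrable _ _ (fun x => c * f x)) => x.
  by apply: cvgM; [exact: cvg_cst|exact: cf].
- apply: (@continuous_itv_integrable _ _ (fun x => d * g x)) => x.
  by apply: cvgM; [exact: cvg_cst|exact: cg].
Qed.

Lemma continuous_cosM (m : R) : continuous (fun t : R => cos (m * t)).
Proof.
by move=> x; apply: continuous_comp; [exact: mulrl_continuous|exact: continuous_cos].
Qed.

Section Kernel.
Variable k : R.
Hypothesis k01 : 0 < k < 1.
Let c := 1 - k ^+ 2.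
Let rho := (1 - k) / (1 + k).
Let den (t : R) := 1 - c * cos t ^+ 2.
Let p n := \int[leb]_(t in `[0, pi]) (cos (n%:R * (2 * t)) / den t).

Let k0 : 0 < k. Proof. by case/andP: k01. Qed.
Let k1 : k < 1. Proof. by case/andP: k01. Qed.

Let den_ge t : k ^+ 2 <= den t.
Proof.
have k2 : 0 <= 1 - k ^+ 2 by have := k0; have := k1; nra.
have := mulr_ge0 k2 (sqr_ge0 (sin t)).
have -> : sin t ^+ 2 = 1 - cos t ^+ 2 by rewrite -(cos2Dsin2 t); ring.
by rewrite /den /c; lra.
Qed.

Let den_gt0 t : 0 < den t.
Proof. by apply: lt_le_trans (den_ge t); rewrite exprn_gt0. Qed.

Let cden : continuous den.
Proof.
move=> x; apply: cvgB; first exact: cvg_cst.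
apply: cvgM; first exact: cvg_cst.
by rewrite expr2; apply: cvgM; exact: continuous_cos.
Qed.

Let cos2M n : (fun t : R => cos (n%:R * (2 * t))) = (fun t => cos (n%:R * 2 * t)).
Proof. by apply/funext => t; rewrite mulrA. Qed.

Let ccos2 n : continuous (fun t : R => cos (n%:R * (2 * t))).
Proof. by rewrite cos2M; exact: continuous_cosM. Qed.

Let ker n (t : R) := cos (n%:R * (2 * t)) / den t.

Let cker n : continuous (ker n).
Proof.
move=> x; apply: cvgM; first exact: ccos2.
by apply: cvgV; [rewrite gt_eqF|exact: cden].
Qed.

Lemma Rintegral_cos2M n :
  \int[leb]_(t in `[0, pi]) cos (n%:R * (2 * t)) = pi * (n == 0)%:R.
Proof.
rewrite cos2M; case: n => [|n].
  under eq_Rintegral do rewrite !mul0r cos0.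
  rewrite Rintegral_cst//= [fine (lebesgue_measure _)](_ : _ = pi); last first.
    by rewrite lebesgue_measure_itv/= lte_fin pi_gt0/= subr0.
  by rewrite mul1r mulr1.
rewrite Rintegral_cosM ?pi_gt0 ?mulf_neq0 ?pnatr_eq0// mulr0 sin0 subr0.
by rewrite -mulrA sin_2pi_mul mul0r mulr0.
Qed.

Let p_rec n : (1 + k ^+ 2) * p n.+1 = c / 2 * (p n.+2 + p n).
Proof.
have E t : (1 + k ^+ 2) * ker n.+1 t + - (c / 2) *
    (1 * ker n.+2 t + 1 * ker n t) = 2 * cos (n.+1%:R * (2 * t)).
  have d0 : den t != 0 by rewrite gt_eqF.
  rewrite /ker; have -> : n.+2%:R * (2 * t) = n.+1%:R * (2 * t) + 2 * t.
    by rewrite -[n.+2%:R]natr1; ring.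
  have -> : n%:R * (2 * t) = n.+1%:R * (2 * t) - 2 * t.
    by rewrite -[n.+1%:R]natr1; ring.
  have c2 : cos (2 * t) = 2 * cos t ^+ 2 - 1 by rewrite mulr_natl cos_mulr2n mulr_natl.
  rewrite cosB cosD c2; move: d0; rewrite /den /c => d0.
  by field.
have cs : continuous (fun t => 1 * ker n.+2 t + 1 * ker n t).
  by move=> x; apply: cvgD; (apply: cvgM; [exact: cvg_cst|exact: cker]).
have := @Rintegral_itvP 0 pi (1 + k ^+ 2) (- (c / 2)) _ _ (@cker n.+1) cs.
under eq_Rintegral do rewrite E.
rewrite RintegralZl//; last exact: continuous_itv_integrable.
rewrite Rintegral_cos2M !mulr0 Rintegral_itvP// !mul1r => /esym/eqP.
by rewrite mulNr subr_eq0 => /eqP.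
Qed.

Let p0_rec : (1 + k ^+ 2) * p 0 = 2 * pi + c * p 1.
Proof.
have E t : (1 + k ^+ 2) * ker 0 t + - c * ker 1 t = 2 * cos (0%:R * (2 * t)).
  have d0 : den t != 0 by rewrite gt_eqF.
  rewrite /ker mul1r mul0r cos0.
  have c2 : cos (2 * t) = 2 * cos t ^+ 2 - 1 by rewrite mulr_natl cos_mulr2n mulr_natl.
  by rewrite c2; move: d0; rewrite /den /c => d0; field.
have := @Rintegral_itvP 0 pi (1 + k ^+ 2) (- c) _ _ (@cker 0) (@cker 1).
under eq_Rintegral do rewrite E.
rewrite RintegralZl//; last exact: continuous_itv_integrable.
by rewrite Rintegral_cos2M mulr1 => ->; rewrite mulNr subrK.
Qed.

Let p_bound n : `|p n| <= pi / k ^+ 2.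
Proof.
have ik := @continuous_itv_integrable 0 pi _ (@cker n).
apply: (le_trans (le_normr_Rintegral _ ik)) => //.
apply: (@le_trans _ _ (\int[leb]_(t in `[0, pi]) (k ^+ 2)^-1)).
  apply: le_Rintegral => //.
  - apply: (@continuous_itv_integrable _ _ (fun t => `|ker n t|)) => x.
    by apply: cvg_norm; exact: cker.
  - by apply: (@continuous_itv_integrable _ _ (cst (k ^+ 2)^-1)); exact: cst_continuous.
  move=> t _; rewrite /ker normrM normfV (gtr0_norm (den_gt0 t)).
  rewrite -[leRHS]mul1r ler_pM ?invr_ge0 ?(ltW (den_gt0 t))//.
    by rewrite ler_norml cos_geN1 cos_le1.
  by rewrite lef_pV2 ?posrE ?exprn_gt0// den_ge.
rewrite Rintegral_cst//= [fine (lebesgue_measure _)](_ : _ = pi) 1?mulrC//.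
by rewrite lebesgue_measure_itv/= lte_fin pi_gt0/= subr0.
Qed.

Lemma continuous_poisson n : continuous (fun t : R =>
  cos (n%:R * (2 * t)) / (1 - (1 - k ^+ 2) * cos t ^+ 2)).
Proof. exact: cker. Qed.

Lemma Rintegral_poisson n :
  \int[leb]_(t in `[0, pi]) (cos (n%:R * (2 * t)) / (1 - (1 - k ^+ 2) * cos t ^+ 2)) =
  pi / k * ((1 - k) / (1 + k)) ^+ n.
Proof.
rewrite -/c -/rho -/(p n).
have kn0 : k != 0 by rewrite gt_eqF.
have k1n0 : 1 + k != 0 by have := k0; lra.
have rho01 : 0 < rho < 1.
  have := k0; have := k1 => h1 h0.
  by rewrite /rho divr_gt0 ?ltr_pdivrMr ?mul1r/=; lra.
have cn0 : 1 - k ^+ 2 != 0 by rewrite gt_eqF//; have := k0; have := k1; nra.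
(* The recurrence has characteristic roots [rho] and [rho^-1]; boundedness
   excludes the second one. *)
have d_rec m : p m.+1 - rho * p m = rho * (p m.+2 - rho * p m.+1).
  have h : p m.+2 = 2 * (1 + k ^+ 2) / (1 - k ^+ 2) * p m.+1 - p m.
    have -> : 2 * (1 + k ^+ 2) / (1 - k ^+ 2) * p m.+1 =
        2 / (1 - k ^+ 2) * ((1 + k ^+ 2) * p m.+1) by field.
    by rewrite p_rec /c; field.
  by rewrite h /rho; field; rewrite k1n0.
have dE m : p 1 - rho * p 0 = rho ^+ m * (p m.+1 - rho * p m).
  elim: m => [|m IH]; first by rewrite mul1r.
  by rewrite IH d_rec mulrA exprSr.
have d0 : p 1 - rho * p 0 = 0.
  pose B := 2 * (pi / k ^+ 2).
  have cv : rho ^+ m * B @[m --> \oo] --> (0 : R).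
    rewrite -[X in _ --> X](mul0r B); apply: cvgM; last exact: cvg_cst.
    by apply: cvg_expr; case/andP: rho01 => ? ?; rewrite ger0_norm ?ltW.
  apply/eqP; rewrite -normr_le0 -(cvg_lim (@Rhausdorff R) cv).
  apply: limr_ge; first exact: (cvgP _ cv).
  apply: nearW => m; rewrite (dE m); case/andP: rho01 => r0 r1.
  rewrite normrM ger0_norm ?exprn_ge0 ?(ltW r0)// ler_wpM2l ?exprn_ge0 ?(ltW r0)//.
  rewrite (le_trans (ler_normB _ _))// /B mulr_natl mulr2n lerD ?p_bound//.
  rewrite normrM (gtr0_norm r0) (le_trans _ (p_bound m))//.
  by rewrite ler_piMl ?normr_ge0// ltW.
have pE m : p m.+1 = rho * p m.
  apply/eqP; rewrite -subr_eq0; have /eqP := dE m; rewrite d0 eq_sym mulf_eq0.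
  by rewrite expf_eq0 gt_eqF ?andbF//; case/andP: rho01.
have p0E : p 0 = pi / k.
  have := p0_rec; rewrite pE /c mulrA.
  have -> : (1 - k ^+ 2) * rho = (1 - k) ^+ 2 by rewrite /rho; field.
  move=> h; have k20 : 2 * k != 0 by rewrite mulf_neq0.
  apply: (mulfI k20); have -> : 2 * k * (pi / k) = 2 * pi by field.
  lra.
elim: n => [|n IH]; first by rewrite mulr1.
by rewrite pE IH exprS mulrCA.
Qed.

End Kernel.
End Poisson.

Section Spectral.
Variable R : realType.
Notation leb := (@lebesgue_measure R).

Definition spectral_poly (k : R) (n : nat) : {poly R} :=
  cheb ('X + (k ^+ 2)%:P) ((1 - k ^+ 2) ^+ 2)%:P n.

Lemma size_spectral_poly k n : size (spectral_poly k n) = n.+1.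
Proof. exact: size_cheb. Qed.

Lemma horner_spectral_poly k n x :
  (spectral_poly k n).[x] = cheb (x + k ^+ 2) ((1 - k ^+ 2) ^+ 2) n.
Proof.
by rewrite -[LHS]/(horner_eval x _) rmorph_cheb/= /horner_eval hornerD hornerX !hornerC.
Qed.

Lemma cheb_scale (c x : R) n : cheb (c * x) (c ^+ 2) n = c ^+ n * cheb x 1 n.
Proof.
elim/nat_ind2: n => [||n IH0 IH1]; [by rewrite mul1r|by rewrite expr1|].
by rewrite !cheb_rec IH0 IH1 !exprS; ring.
Qed.

(* The substitution is [psi = F t], i.e. [cos psi = s * cos t]. *)
Section Substitution.
Variable k : R.
Hypothesis k01 : 0 < `|k| < 1.
Let c := 1 - k ^+ 2.
Let s := Num.sqrt c.
Let F (t : R) := acos (s * cos t).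
Let D (t : R) := Num.sqrt (1 - (s * cos t) ^+ 2).
Let F' (t : R) := s * sin t / D t.

Let k2 : 0 < k ^+ 2 < 1.
Proof. by rewrite -real_normK ?num_real// exprn_gt0 ?exprn_ilt1//; case/andP: k01 => // /ltW. Qed.

Let c01 : 0 < c < 1.
Proof. by case/andP: k2; rewrite /c; lra. Qed.

Let s01 : 0 < s < 1.
Proof.
case/andP: c01 => c0 c1; rewrite sqrtr_gt0 c0 -sqrtr1 ltr_sqrt//.
Qed.

Let ss : s ^+ 2 = c. Proof. by rewrite sqr_sqrtr// ltW//; case/andP: c01. Qed.

Let sc t : -1 < s * cos t < 1.
Proof.
rewrite -ltr_norml normrM; case/andP: s01 => s0 s1; rewrite (gtr0_norm s0).
by rewrite (le_lt_trans _ s1)// ler_piMr ?(ltW s0)// ler_norml cos_geN1 cos_le1.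
Qed.

Let sc' t : -1 <= s * cos t <= 1.
Proof. by case/andP: (sc t) => ? ?; rewrite !ltW. Qed.

Let D_gt0 t : 0 < D t.
Proof. by rewrite sqrtr_gt0 subr_gt0; have := sc t => /andP[? ?]; nra. Qed.

Let F0pi t : F t \in `[0, pi].
Proof. by rewrite in_itv/= acos_ge0 ?acos_lepi. Qed.

Let cosF t : cos (F t) = s * cos t.
Proof. by rewrite acosK// in_itv/=. Qed.

Let sinF t : sin (F t) = D t.
Proof. by rewrite sin_acos. Qed.

Let F_inc : {in `[0, pi] &, {homo F : x y / x < y}}.
Proof.
move=> x y xi yi xy; rewrite -ltr_cos// !cosF ltr_pM2l; last by case/andP: s01.
by rewrite ltr_cos.
Qed.

Let dF (t : R) : is_derive t 1 F (F' t).
Proof.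
have dacos := is_derive1_acos (sc t).
by apply: is_derive_eq; rewrite /F' -/(D t) /GRing.scale/= mulrN mulrNN mulrC.
Qed.

Let cF' : continuous F'.
Proof.
move=> x; apply: cvgM.
  by apply: cvgM; [exact: cvg_cst|exact: continuous_sin].
apply: cvgV; first by rewrite gt_eqF.
apply: (@continuous_comp _ _ _ (fun t => 1 - (s * cos t) ^+ 2) Num.sqrt);
  last exact: sqrt_continuous.
apply: cvgB; first exact: cvg_cst.
by rewrite expr2; apply: cvgM; (apply: cvgM; [exact: cvg_cst|exact: continuous_cos]).
Qed.

Let G (Q : {poly R}) (t : R) := Q.[cos (2 * t)] * Num.sqrt (1 - k ^+ 2 / sin t ^+ 2).

Let c2 (t : R) : cos (2 * t) = 2 * cos t ^+ 2 - 1.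
Proof. by rewrite mulr_natl cos_mulr2n mulr_natl. Qed.

Let sin_neq0 t : t \in `[F 0, F pi] -> sin t != 0.
Proof.
rewrite in_itv/= => /andP[t0 tpi]; rewrite gt_eqF// sin_gt0_pi//.
have /andP[h1 h2] := sc 0; have /andP[h3 h4] := sc pi.
rewrite (lt_le_trans _ t0) ?acos_gt0 ?h2 ?(ltW h1)//=.
by rewrite (le_lt_trans tpi)// acos_ltpi ?h3 ?(ltW h4).
Qed.

Let cG Q : {within `[F 0, F pi], continuous (G Q)}.
Proof.
apply: continuous_in_subspaceT => t /set_mem/= ti.
have c1 : {for t, continuous (fun t : R => Q.[cos (2 * t)])}.
  apply: (@continuous_comp R R R (fun t => cos (2 * t)) (horner Q));
    last exact: continuous_horner.
  exact: continuous_cosM.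
have c3 : {for t, continuous (fun t : R => Num.sqrt (1 - k ^+ 2 / sin t ^+ 2))}.
  apply: (@continuous_comp R R R (fun t => 1 - k ^+ 2 / sin t ^+ 2) Num.sqrt);
    last exact: sqrt_continuous.
  apply: cvgB; first exact: cvg_cst.
  apply: cvgM; first exact: cvg_cst.
  apply: cvgV; first by rewrite expf_neq0// sin_neq0.
  by rewrite expr2; apply: cvgM; exact: continuous_sin.
exact: (continuousM c1 c3).
Qed.

Let densityE (t : R) : t \in `[0, pi] ->
  spectral_density k t =
    if t \in `[F 0, F pi] then Num.sqrt (1 - k ^+ 2 / sin t ^+ 2) else 0.
Proof.
move=> ti; rewrite /spectral_density indicE.
have -> : (t \in [set t | `|k| <= `|sin t|]) = (t \in `[F 0, F pi]).
  have leC (x y : R) : x \in `[0, pi] -> y \in `[0, pi] -> (x <= y) = (cos y <= cos x).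
    by move=> xi yi; rewrite !leNgt ltr_cos.
  rewrite in_itv/= (leC (F 0))// (leC t)// !cosF cos0 cospi mulr1 mulrN1.
  have s0 : 0 <= s by case/andP: s01 => /ltW.
  have sqE (x y : R) : (`|x| <= `|y|) = (x ^+ 2 <= y ^+ 2).
    by rewrite -ler_sqr ?nnegrE// !real_normK ?num_real.
  have -> : (t \in [set t | `|k| <= `|sin t|]) = (k ^+ 2 <= sin t ^+ 2).
    by rewrite -sqE; apply/idP/idP => [/set_mem//|?]; exact/mem_set.
  rewrite andbC -ler_norml -[X in _ = (_ <= X)](ger0_norm s0) sqE ss /c.
  by rewrite -(cos2Dsin2 t); apply/idP/idP; lra.
by case: ifP; rewrite ?mulr1 ?mulr0.
Qed.

Lemma Rintegral_substitution Q :
  \int[leb]_(t in `[0, pi]) (Q.[cos (2 * t)] * spectral_density k t) =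
  \int[leb]_(t in `[0, pi]) (Q.[c * cos (2 * t) - k ^+ 2]
     * (1 - k ^+ 2 / (1 - c * cos t ^+ 2))).
Proof.
transitivity (\int[leb]_(t in `[F 0, F pi]) G Q t).
  rewrite Rintegral_mkcond [RHS]Rintegral_mkcond; apply: eq_Rintegral => t _.
  rewrite !patchE; case: ifPn => [/set_mem/= ti|tn].
    rewrite densityE//; case: ifPn => tF; first by rewrite mem_set.
    by rewrite mulr0 memNset//; exact/negP.
  rewrite memNset// => /= tF; move/negP: tn; apply; apply/mem_set => /=.
  move: tF; rewrite !in_itv/= => /andP[h1 h2]; have := F0pi 0; have := F0pi pi.
  by rewrite !in_itv/= => /andP[_ h3] /andP[h4 _]; rewrite (le_trans h4)// (le_trans h2).
have dFE : derive1 F = F' by apply/funext => t; rewrite derive1E; have := dF t => -[].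
have cF : continuous F.
  move=> x; apply: differentiable_continuous; apply/derivable1_diffP.
  by have := dF x => -[].
rewrite /Rintegral (@integration_by_substitution_increasing R F (G Q) 0 pi)//.
- congr fine; apply: eq_integral => t /set_mem/=; rewrite in_itv/= => ti; congr EFin.
  rewrite fctE dFE /= /G /F' c2 cosF sinF.
  have s2 : sin t ^+ 2 = 1 - cos t ^+ 2 by rewrite -(cos2Dsin2 t) addrAC subrr add0r.
  have D2 : D t ^+ 2 = 1 - c * cos t ^+ 2.
    by rewrite sqr_sqrtr ?exprMn ?ss//; move: (D_gt0 t); rewrite sqrtr_gt0 exprMn ss => /ltW.
  have -> : 2 * (s * cos t) ^+ 2 - 1 = c * cos (2 * t) - k ^+ 2.
    by rewrite exprMn ss c2 /c; ring.
  have st : 0 <= s * sin t / D t.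
    by rewrite divr_ge0 ?(ltW (D_gt0 t))// mulr_ge0 ?sin_ge0_pi// ltW//; case/andP: s01.
  have D0 : D t ^+ 2 != 0 by rewrite expf_neq0// gt_eqF.
  have -> : 1 - k ^+ 2 / D t ^+ 2 = (s * sin t / D t) ^+ 2.
    rewrite expr_div_n exprMn ss -[1](divff D0) -mulrBl; congr (_ / _).
    by rewrite D2 s2 /c; ring.
  rewrite sqrtr_sqr ger0_norm//; set X := s * sin t / D t.
  rewrite -(mulrA _ X) -expr2; congr (_ * _); rewrite {}/X.
  rewrite -D2 expr_div_n exprMn ss -[1](divff D0) -mulrBl; congr (_ / _).
  by rewrite D2 s2 /c; ring.
- exact: pi_ge0.
- by rewrite dFE => x _; exact: cF'.
- by rewrite dFE; apply/cvg_ex; exists (F' 0); apply/cvg_at_right_filter/cF'.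
- by rewrite dFE; apply/cvg_ex; exists (F' pi); apply/cvg_at_left_filter/cF'.
- split.
  + by move=> x _; have := dF x => -[].
  + exact/cvg_at_right_filter/cF.
  + exact/cvg_at_left_filter/cF.
Qed.

End Substitution.

Lemma spectral_moment (k : R) n : `|k| <= 1 ->
  \int[leb]_(t in `[0, pi]) ((spectral_poly k n).[cos (2 * t)] * spectral_density k t) =
  pi * ((n == 0)%:R - `|k| * (1 - `|k|) ^+ (2 * n)).
Proof.
have c2M m t : cheb (cos (2 * t)) 1 m = cos (m%:R * (2 * t)).
  by rewrite -horner_chebT chebT_cos.
rewrite le_eqVlt => /predU1P[k1|k1].
  rewrite k1 subrr mul1r expr0n muln_eq0/= subrr mulr0.
  have w0 t : spectral_density k t = 0.
    have kk : k ^+ 2 = 1 by rewrite -real_normK ?num_real// k1 expr1n.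
    have ss : sin t ^+ 2 <= 1 by rewrite -(cos2Dsin2 t) lerDr sqr_ge0.
    rewrite /spectral_density kk k1 indicE.
    have [s0|s0] := eqVneq (sin t) 0.
      rewrite memNset ?mulr0//= => /=; rewrite s0 normr0 => h; lra.
    rewrite ler0_sqrtr ?mul0r// subr_le0 ler_pdivlMr ?mul1r//.
    by rewrite exprn_even_gt0.
  by under eq_Rintegral do rewrite w0 mulr0; rewrite Rintegral_cst ?mul0r.
have [->|k0] := eqVneq k 0.
  have w1 t : spectral_density 0 t = 1 :> R.
    rewrite /spectral_density expr0n mul0r subr0 sqrtr1 mul1r indicE mem_set//=.
    by rewrite normr0.
  under eq_Rintegral do rewrite w1 mulr1 horner_spectral_poly expr0n addr0 subr0 expr1n c2M.
  by rewrite Rintegral_cos2M normr0 mul0r subr0.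
have k01 : 0 < `|k| < 1 by rewrite normr_gt0 k0.
rewrite Rintegral_substitution//.
have k2 : k ^+ 2 = `|k| ^+ 2 by rewrite real_normK ?num_real.
rewrite k2; set r := `|k| in k01 k2 *.
have cc t : (spectral_poly k n).[(1 - r ^+ 2) * cos (2 * t) - r ^+ 2] =
    (1 - r ^+ 2) ^+ n * cos (n%:R * (2 * t)).
  by rewrite horner_spectral_poly k2 subrK cheb_scale c2M.
have E t : (spectral_poly k n).[(1 - r ^+ 2) * cos (2 * t) - r ^+ 2] *
     (1 - r ^+ 2 / (1 - (1 - r ^+ 2) * cos t ^+ 2)) =
   (1 - r ^+ 2) ^+ n * cos (n%:R * (2 * t)) + - ((1 - r ^+ 2) ^+ n * r ^+ 2) *
   (cos (n%:R * (2 * t)) / (1 - (1 - r ^+ 2) * cos t ^+ 2)).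
  by rewrite cc; ring.
under eq_Rintegral do rewrite E.
rewrite Rintegral_itvP; last 2 first.
- have := @continuous_cosM R (n%:R * 2).
  by under eq_fun do rewrite -mulrA.
- exact: continuous_poisson.
rewrite Rintegral_cos2M Rintegral_poisson//.
case/andP: k01 => r0 r1.
have r1n0 : 1 + r != 0 by lra.
have rn0 : r != 0 by rewrite gt_eqF.
have e1 : (1 - r ^+ 2) ^+ n * ((1 - r) / (1 + r)) ^+ n = (1 - r) ^+ (2 * n).
  rewrite -exprMn exprM; congr (_ ^+ n); by field.
have -> (Z Y : R) : - (Z * r ^+ 2) * (pi / r * Y) = - pi * r * (Z * Y) by field.
have e2 m : (1 - r ^+ 2) ^+ m * (pi * (m == 0)%:R) = pi * (m == 0)%:R.
  by case: m => [|m]; rewrite ?mul1r ?mulr0.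
by rewrite e1 e2 mulrBr !mulNr mulrA.
Qed.
End Spectral.

(** * The spectral distribution *)

Section FreeSymmetriesOfProjection.
Variables (R : realType) (A : algType R[i]) (star : A -> A).
Variables (tau : {scalar A}) (P U : A) (theta : R).
Let S := 2 * P - 1.
Let kappa := 2 * theta - 1.
Hypothesis wstar : wstar_probability_space star tau.
Hypothesis projP : orthogonal_projection star P.
Hypothesis tauP : tau P = theta%:C.
Hypothesis haarU : haar_unitary star tau U.
Hypothesis freeUP : star_free star tau U P.

Let b := U * S * star U.

Let starP (c : R[i]) (x y : A) : star (c *: x + y) = c^* *: star x + star y.
Proof. by case: wstar => -[[+ _ _] _] _; apply. Qed.

Let starM x y : star (x * y) = star y * star x.
Proof. by case: wstar => -[[_ + _] _] _; apply. Qed.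

Let starK x : star (star x) = x.
Proof. by case: wstar => -[[_ _ +] _] _; apply. Qed.

Let trace x y : tau (x * y) = tau (y * x).
Proof. by case: wstar => _ [_ _ _]; apply. Qed.

Let tau1 : tau 1 = 1. Proof. by case: wstar => _ []. Qed.

Let star1 : star 1 = 1.
Proof. by rewrite -[LHS]mul1r -{1}(starK 1) -starM mul1r starK. Qed.

Let SE : S = 2 *: P - 1.
Proof. by rewrite /S scaler_nat mulr_natl. Qed.

Let starS : star S = S.
Proof.
have [sP _] := projP.
have -> : S = (-1) *: 1 + 2 *: P by rewrite SE scaleN1r addrC.
rewrite -[2 *: P]addr0 !starP star1 sP.
have -> : star 0 = 0.
  have := starP (-1) 1 1; rewrite scaleN1r addNr star1 => ->.
  by rewrite rmorphN rmorph1 scaleN1r addNr.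
by rewrite rmorphN rmorph1 rmorph_nat.
Qed.

Let SS : S * S = 1.
Proof.
have [_ PP] := projP.
rewrite SE mulrBr mulr1 mulrBl mul1r -scalerAl -scalerAr PP scalerA.
have -> : (2 * 2 : R[i]) = 2 + 2 by ring.
by rewrite scalerDl addrK opprB addrC subrK.
Qed.

Let bb : b * b = 1.
Proof.
have [[UU UU'] _] := haarU.
by rewrite /b -!mulrA (mulrA (star U)) UU' mul1r (mulrA S S) SS mul1r.
Qed.

Let tauS : tau S = kappa%:C.
Proof. by rewrite SE linearB linearZ/= tauP tau1 /kappa rmorphB rmorphM rmorph1 rmorph_nat. Qed.

Let taub : tau b = kappa%:C.
Proof.
have [[_ UU'] _] := haarU.
by rewrite /b trace mulrA UU' mul1r tauS.
Qed.

Let centered := S - kappa%:C%:A.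

Let gen_centered : star_subalgebra_generated star P centered.
Proof.
move=> B [B1 BP BM Bs] BPP.
have B0 : B 0 by have := BP (-1) 1 1 B1 B1; rewrite scaleN1r addNr.
have -> : centered = 2 *: P + (- (1 + kappa%:C) *: 1 + 0).
  by rewrite /centered SE addr0 scaleNr (scalerDl _ 1 kappa%:C) scale1r opprD addrA.
exact: BP _ _ _ BPP (BP _ _ _ B1 B0).
Qed.

Let centered_word m := flatten (nseq m
  [:: (false, centered); (true, U); (false, centered); (true, star U)]).

Let centered_wordE m :
  \prod_(p <- centered_word m) p.2 =
  ((S - kappa%:C%:A) * (b - kappa%:C%:A)) ^+ m.
Proof.
have [[UU _] _] := haarU.
elim: m => [|m IH]; first by rewrite big_nil.
rewrite /centered_word /= !big_cons -/(centered_word m) IH exprS !mulrA.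
congr (_ * _); rewrite -!mulrA; congr (_ * _).
by rewrite /centered mulrBl mulrBr -scalerAl mul1r -scalerAr UU /b mulrA.
Qed.

Let trace_centered_word m : tau (((S - kappa%:C%:A) * (b - kappa%:C%:A)) ^+ m.+1) = 0.
Proof.
have [_ hU] := haarU.
rewrite -centered_wordE; apply: freeUP => //.
  rewrite /centered_word /=; elim: m => //= m ->.
move=> p; rewrite /centered_word => /flattenP[s /nseqP[-> _]].
have tU : tau U = 0 by exact: (hU (Posz 1) isT).
have tU' : tau (star U) = 0 by exact: (hU (Negz 0) isT).
have tc : tau centered = 0 by rewrite /centered linearB linearZ/= tauS tau1 mulr1 subrr.
have gU : star_subalgebra_generated star U U by move=> B.
have gU' : star_subalgebra_generated star U (star U) by move=> B [_ _ _ Bs] BU; exact: Bs.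
by rewrite !inE => /or4P[] /eqP->.
Qed.

Let x := 2^-1 *: (S * b + b * S).

Lemma trace_cheb_projection n :
  tau (cheb (x + (kappa%:C ^+ 2)%:A) ((1 - kappa%:C ^+ 2) ^+ 2)%:A n) =
  (n == 0)%:R + kappa%:C * ((1 + kappa%:C) ^+ (2 * n) - (1 - kappa%:C) ^+ (2 * n)) / 2.
Proof.
apply: (trace_cheb_symmetries trace n SS bb tau1 tauS taub trace_centered_word).
by rewrite /x -scaler_nat scalerA divff ?scale1r.
Qed.

Lemma trace_pow_symmetries n :
  tau ((S * b) ^+ n) = tau ((b * S) ^+ n).
Proof.
by rewrite -[in LHS](mulr1 ((S * b) ^+ n)) -SS mulrA expr_flip trace mulrA SS mul1r.
Qed.

Lemma cheb_symmetries n :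
  cheb x 1 n = 2^-1 *: ((S * b) ^+ n + (b * S) ^+ n).
Proof.
rewrite (@cheb_pair A _ _ x 1).
- by rewrite -[cheb _ _ _ *+ 2]scaler_nat scalerA mulVf ?scale1r// pnatr_eq0.
- by rewrite /x -scaler_nat scalerA divff ?scale1r.
- by rewrite mulrA -(mulrA S) bb mulr1 SS.
- by rewrite mulrA -(mulrA b) SS mulr1 bb.
Qed.

Lemma upow_symmetries n :
  upow star (S * U * S * star U) n =
  match n with Posz m => (S * b) ^+ m | Negz m => (b * S) ^+ m.+1 end.
Proof.
have -> : S * U * S * star U = S * b by rewrite /b !mulrA.
case: n => //= n; congr (_ ^+ _).
by rewrite starM starS /b !starM starS starK !mulrA.
Qed.

End FreeSymmetriesOfProjection.

Section CirclePowers.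
Variable R : realType.
Implicit Types z : circle R.

Lemma circle_valE z : circle_val z = re z +i* im z.
Proof. by rewrite /re /im; case: (circle_val z). Qed.

Lemma circle_conj z : circle_val z * (circle_val z)^* = 1.
Proof.
rewrite -normCK; case: z => v /= /eqP ->; exact: expr1n.
Qed.

Lemma circle_ReX z n : complex.Re (circle_val z ^+ n) = (chebT R n).[re z].
Proof.
have := @cheb_pair R[i] (circle_val z) (circle_val z)^* (re z)%:C 1 n.
have sumz : circle_val z + (circle_val z)^* = (re z)%:C *+ 2.
  by rewrite circle_valE mulr2n /=; apply/eqP; rewrite eq_complex /= addr0 addrN !eqxx.
move=> /(_ sumz (circle_conj z)); rewrite mulrC => /(_ (circle_conj z)).
rewrite -rmorphXn -(rmorph_cheb (real_complex R)) horner_chebT => /(congr1 (@complex.Re R)).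
by case: (_ ^+ n) => u v /=; lra.
Qed.

Lemma circle_ImS z n : complex.Im (circle_val z ^+ n.+1) =
  re z * complex.Im (circle_val z ^+ n) + im z * complex.Re (circle_val z ^+ n).
Proof. by rewrite exprS {1}circle_valE; case: (_ ^+ n). Qed.

Lemma circle_exprN z n : circle_val z ^- n = (circle_val z ^+ n)^*.
Proof.
have e : circle_val z ^+ n * (circle_val z ^+ n)^* = 1.
  by rewrite rmorphXn -exprMn circle_conj expr1n.
have n0 : circle_val z ^+ n != 0.
  by apply: contra_eq_neq e => ->; rewrite mul0r eq_sym oner_eq0.
by apply: (mulfI n0); rewrite e divff.
Qed.

Lemma trig_ImX n : trig (fun z : circle R => complex.Im (circle_val z ^+ n)).
Proof.
elim: n => [|n IH].
  rewrite (_ : (fun _ => _) = cst 0); first exact: trig_cst.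
  by apply/funext => z; rewrite expr0.
rewrite (_ : (fun _ => _) = (@re R \* (fun z => complex.Im (circle_val z ^+ n))) \+
   (fun z => im z * (chebT R n).[re z])).
  by apply: trigD; [apply: trigM => //; exact: trig_re|exact: trig_im_horner_re].
by apply/funext => z; rewrite circle_ImS circle_ReX.
Qed.

Lemma circle_im_cheb z n : im z * (chebT R n.+1).[re z] =
  2^-1 * (complex.Im (circle_val z ^+ n.+2)) + (- 2^-1) * complex.Im (circle_val z ^+ n).
Proof.
have zw : circle_val z ^+ n = (circle_val z)^* * circle_val z ^+ n.+1.
  by rewrite exprS mulrA (mulrC _^*) circle_conj mul1r.
rewrite -circle_ReX circle_ImS zw; move: (_ ^+ n.+1) => w.
by rewrite circle_valE; case: w => u v /=; field.
Qed.

End CirclePowers.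

Section MomentsOfMu.
Variables (R : realType) (mu : probability (circle R) R).

Lemma circle_moment_pos n : circle_moment mu (Posz n) =
  (\int[mu]_z (chebT R n).[re z]) +i* (\int[mu]_z complex.Im (circle_val z ^+ n)).
Proof.
rewrite /circle_moment; congr (_ +i* _).
by apply: eq_Rintegral => z _; rewrite -circle_ReX.
Qed.

Lemma circle_moment_neg n : circle_moment mu (Negz n) =
  (\int[mu]_z (chebT R n.+1).[re z]) +i* (- \int[mu]_z complex.Im (circle_val z ^+ n.+1)).
Proof.
rewrite /circle_moment; congr (_ +i* _).
  apply: eq_Rintegral => z _; rewrite -circle_ReX -[circle_val z ^ _]/(_ ^- n.+1).
  by rewrite circle_exprN; case: (_ ^+ _).
have := Rintegral_trig_linear mu (-1) (trig_ImX R n.+1) (trig_cst 0).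
rewrite Rintegral_cst//= mul0r addr0 mulN1r => <-.
apply: eq_Rintegral => z _; rewrite -[circle_val z ^ _]/(_ ^- n.+1) circle_exprN.
by case: (_ ^+ _) => u v /=; rewrite mulN1r addr0.
Qed.

Hypothesis sym : forall n : nat, circle_moment mu (Posz n.+1) = circle_moment mu (Negz n).

Lemma symmetric_moment_im n : \int[mu]_z complex.Im (circle_val z ^+ n) = 0.
Proof.
case: n => [|n].
  under eq_Rintegral do rewrite expr0/=.
  by rewrite Rintegral_cst// mul0r.
by have := sym n; rewrite circle_moment_pos circle_moment_neg => -[]; lra.
Qed.

Lemma symmetric_im_horner (q : {poly R}) : \int[mu]_z (im z * q.[re z]) = 0.
Proof.
move: q; apply: (poly_graded_ind (@size_chebT R)) => [|c p q IHp IHq|].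
- under eq_Rintegral do rewrite horner0 mulr0.
  by rewrite Rintegral_cst// mul0r.
- under eq_Rintegral do rewrite hornerD hornerZ mulrDr mulrCA.
  rewrite (Rintegral_trig_linear mu c (trig_im_horner_re p) (trig_im_horner_re q)).
  by rewrite IHp IHq mulr0 addr0.
case => [|n].
  rewrite -(symmetric_moment_im 1); apply: eq_Rintegral => z _.
  by rewrite hornerC mulr1 expr1.
under eq_Rintegral do rewrite circle_im_cheb.
rewrite (Rintegral_trig_linear mu _ (trig_ImX R _) (trigZ _ (trig_ImX R _))).
have := Rintegral_trig_linear mu (- 2^-1) (trig_ImX R n) (trig_cst 0).
under eq_Rintegral do rewrite addr0.
by move=> ->; rewrite !symmetric_moment_im Rintegral_cst// mul0r !mulr0 !addr0.
Qed.

End MomentsOfMu.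

Section Density.
Variables (R : realType) (k : R).
Hypothesis k1 : `|k| <= 1.

(* [spectral_density k psi] as a function of [z = e^(2 i psi)]. *)
Definition circle_density (z : circle R) : R :=
  Num.sqrt (1 - 2 * k ^+ 2 / (1 - re z)) * (2 * k ^+ 2 <= 1 - re z)%R%:R.

Lemma circle_density_expM t : circle_density (circle_expM 2 t) = spectral_density k t.
Proof.
have c2 : 1 - re (circle_expM 2 t) = 2 * sin t ^+ 2.
  have s2 : sin t ^+ 2 = 1 - cos t ^+ 2 by rewrite -(cos2Dsin2 t) addrAC subrr add0r.
  by rewrite /circle_expM re_exp mulr_natl cos_mulr2n s2 -[_ *+ 2]mulr_natl; ring.
rewrite /circle_density c2 /spectral_density; congr (Num.sqrt (1 - _) * _).
  by rewrite -mulf_div divff ?mul1r.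
rewrite ler_pM2l// indicE; congr (nat_of_bool _)%:R.
rewrite -[k ^+ 2]real_normK ?num_real// -[sin t ^+ 2]real_normK ?num_real//.
by rewrite ler_sqr ?nnegrE//; apply/idP/idP => [?|/set_mem//]; exact/mem_set.
Qed.

Lemma circle_density_itv z : 0 <= circle_density z <= 1.
Proof.
have := re_itv z => /andP[_ r1].
rewrite /circle_density mulr_ge0 ?sqrtr_ge0//= mulr_ile1 ?sqrtr_ge0 ?lern1 ?leq_b1//.
rewrite -[leRHS]sqrtr1 ler_sqrt// gerBl; apply: divr_ge0; last by rewrite subr_ge0.
by rewrite mulr_ge0 ?sqr_ge0.
Qed.

Lemma measurable_invr : measurable_fun setT (@GRing.inv R).
Proof.
rewrite -(setUv [set (0 : R)]); apply/measurable_funU => //.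
  exact: measurableC.
split; first exact: measurable_fun_set1.
apply: open_continuous_measurable_fun.
  by rewrite openC; exact: closed_eq.
by move=> x /set_mem/= /eqP x0; exact: inv_continuous.
Qed.

Lemma measurable_circle_density : measurable_fun setT circle_density.
Proof.
have m1 : measurable_fun setT (fun z => 1 - @re R z).
  by apply: measurable_funB => //; exact: measurable_re.
have m2 : measurable_fun setT (fun z => 1 - 2 * k ^+ 2 / (1 - @re R z)).
  apply: measurable_funB => //; apply: measurable_funM => //.
  exact: (measurableT_comp measurable_invr m1).
apply: measurable_funM.
  exact: (measurableT_comp (continuous_measurable_fun (@sqrt_continuous R)) m2).
rewrite (_ : (fun z => _) = (fun z => if (2 * k ^+ 2 <= 1 - re z)%R then 1 else 0)).
  by apply: measurable_fun_ifT => //; apply: measurable_fun_ler.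
by apply/funext => z; case: ifP.
Qed.

End Density.

Section HaarParametrizations.
Variable R : realType.

Lemma exp_uniform_unique (a b k a' b' k' : R) (ab : a < b) (ab' : a' < b') B :
  k != 0 -> k' != 0 ->
  (forall n : nat, cos (n%:R * (k * b)) = cos (n%:R * (k * a))) ->
  (forall n : nat, sin (n%:R * (k * b)) = sin (n%:R * (k * a))) ->
  (forall n : nat, cos (n%:R * (k' * b')) = cos (n%:R * (k' * a'))) ->
  (forall n : nat, sin (n%:R * (k' * b')) = sin (n%:R * (k' * a'))) ->
  measurable B -> exp_uniform ab k B = exp_uniform ab' k' B.
Proof.
move=> k0 k0' c s c' s' mB; apply: circle_prob_unique => // n.
  by rewrite !exp_uniform_re.
by rewrite !exp_uniform_im.
Qed.

Let u2 := two_pi_gt0 R.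

Let cos4 n : cos (n%:R * (2 * (2 * pi))) = cos (n%:R * (2 * 0)) :> R.
Proof. by rewrite !mulr0 cos0 mulrA -natrM cos_2pi_mul. Qed.

Let sin4 n : sin (n%:R * (2 * (2 * pi))) = sin (n%:R * (2 * 0)) :> R.
Proof. by rewrite !mulr0 sin0 mulrA -natrM sin_2pi_mul. Qed.

Let cosN4 n : cos (n%:R * (-2 * (2 * pi))) = cos (n%:R * (-2 * 0)) :> R.
Proof. by rewrite !mulNr !mulrN !cosN cos4. Qed.

Let sinN4 n : sin (n%:R * (-2 * (2 * pi))) = sin (n%:R * (-2 * 0)) :> R.
Proof. by rewrite !mulNr !mulrN !sinN sin4. Qed.

Lemma haar_circleE B : measurable B ->
  haar_circle B = exp_uniform u2 2 B.
Proof.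
move=> mB; rewrite (_ : haar_circle B = exp_uniform u2 1 B); last first.
  rewrite /haar_circle /exp_uniform /distribution /pushforward /=.
  congr (uniform_prob _ _).
  by apply/funext => t; rewrite /preimage/= /circle_expM mul1r.
apply: exp_uniform_unique => // [n|n].
  by rewrite !mul1r mulr0 cos0 cos_2pi_mul.
by rewrite !mul1r mulr0 sin0 sin_2pi_mul.
Qed.

Lemma Rintegral_haar_half_period (f : circle R -> R) :
  measurable_fun setT f -> (exists M, forall z, `|f z| <= M) ->
  \int[exp_uniform u2 2]_z f z =
  pi^-1 * \int[lebesgue_measure]_(t in `[0, pi]) f (circle_expM 2 t).
Proof.
move=> mf bf.
have := @Rintegral_exp_uniform R 0 pi (pi_gt0 R) 2 f mf bf; rewrite subr0 => <-.
congr fine; apply: eq_measure_integral => B mB _.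
apply: exp_uniform_unique => // n.
  by rewrite !mulr0 cos0 cos_2pi_mul.
by rewrite !mulr0 sin0 sin_2pi_mul.
Qed.

Lemma Rintegral_haar_odd (f : circle R -> R) :
  measurable_fun setT f -> (exists M, forall z, `|f z| <= M) ->
  (forall t, f (circle_exp (- t)) = - f (circle_exp t)) ->
  \int[exp_uniform u2 2]_z f z = 0.
Proof.
move=> mf bf fN.
have e : \int[exp_uniform u2 2]_z f z = \int[exp_uniform u2 (-2)]_z f z.
  congr fine; apply: eq_measure_integral => B mB _.
  by apply: exp_uniform_unique.
have : \int[exp_uniform u2 (-2)]_z f z = - \int[exp_uniform u2 2]_z f z.
  rewrite !Rintegral_exp_uniform// -mulrN; congr (_ * _).
  have [M fM] := bf.
  rewrite -[RHS]mulN1r -RintegralZl//.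
    by apply: eq_Rintegral => t _; rewrite /circle_expM mulNr fN mulN1r.
  apply: measurable_bounded_integrable => //.
  - by rewrite /= lebesgue_measure_itv/=; case: ifP => _; rewrite ?ltry.
  - apply: measurable_funTS; apply: (measurableT_comp mf).
    exact: measurable_circle_expM.
  - exists M; split; first exact: num_real.
    by move=> y My t _ /=; rewrite (le_trans (fM _))// ltW.
by rewrite -e; lra.
Qed.

Lemma haar_circle_one : haar_circle [set circle_one R] = 0%E.
Proof.
rewrite /haar_circle /pushforward /uniform_prob integral_uniform_pdf.
set N := _ `&` _.
have NE : N = [set 0; 2 * pi].
  apply/seteqP; split => [t|t]; rewrite /N /= in_itv/=.
    move=> [te /andP[t0 t2]].
    have ct : cos t = 1.
      by have := congr1 (@re R) te; rewrite !re_exp cos0.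
    have [tpi|tpi] := leP t pi.
      left; apply: (@cos_inj R); rewrite ?in_itv/= ?t0 ?tpi ?lexx ?pi_ge0// ct cos0//.
    right; apply/eqP; rewrite -subr_eq0 -oppr_eq0 opprB; apply/eqP.
    apply: (@cos_inj R); rewrite ?in_itv/= ?lexx ?pi_ge0 ?subr_ge0 ?t2//=.
      by rewrite mulr_natl mulr2n lerBlDr lerD2l ltW.
    by rewrite mulr_natl addrC cosD2pi cosN ct cos0.
  have pi0 := pi_ge0 R.
  case=> ->; rewrite ?lexx; split => //; rewrite ?mulr_ge0//; last first.
  - by apply/eqP; rewrite -val_eqE /= mulr_natl cos2pi sin2pi cos0 sin0.
rewrite NE; apply: null_set_integral.
- by apply: measurableU; exact: measurable_set1.
- by apply/measurable_EFinP/measurable_funTS; exact: measurable_uniform_pdf.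
- apply: countable_lebesgue_measure0; apply: finite_set_countable.
  by rewrite finite_setU; split; exact: finite_set1.
Qed.

End HaarParametrizations.

Section SpectralMeasure.
Variables (R : realType) (k : R).
Hypothesis k1 : `|k| <= 1.
Let lambda := exp_uniform (two_pi_gt0 R) 2.

Lemma half_angle_measureE B : measurable B ->
  half_angle_measure (spectral_density k) B =
  (\int[lambda]_(z in B) (circle_density k z)%:E)%E.
Proof.
move=> mB; rewrite ge0_integral_pushforward//.
- by apply: eq_integral => t _; rewrite /= circle_density_expM.
- by apply/measurable_EFinP/measurable_funTS; exact: measurable_circle_density.
- by move=> z _; rewrite lee_fin; case/andP: (circle_density_itv k z).
Qed.

Let measurable_trig_density f : trig f ->
  measurable_fun setT (fun z => f z * circle_density k z).
Proof.
move=> tf; apply: measurable_funM; first exact: measurable_trig.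
exact: measurable_circle_density.
Qed.

Let norm_density z : `|circle_density k z| <= 1.
Proof. by have /andP[? ?] := circle_density_itv k z; rewrite ger0_norm. Qed.

Let bounded_trig_density f : trig f ->
  exists M, forall z, `|f z * circle_density k z| <= M.
Proof.
move=> /trig_bounded[M fM]; exists M => z.
by rewrite normrM (le_trans (ler_piMr _ (norm_density z)))// fM.
Qed.

Lemma horner_spectral_poly1 n :
  (spectral_poly k n).[1] = ((1 + k) ^+ (2 * n) + (1 - k) ^+ (2 * n)) / 2.
Proof.
have e1 : (1 + k) ^+ 2 + (1 - k) ^+ 2 = (1 + k ^+ 2) *+ 2 by ring.
have e2 : (1 + k) ^+ 2 * (1 - k) ^+ 2 = (1 - k ^+ 2) ^+ 2 by ring.
have e3 : (1 - k) ^+ 2 * (1 + k) ^+ 2 = (1 - k ^+ 2) ^+ 2 by ring.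
have := cheb_pair n e1 e2 e3; rewrite -horner_spectral_poly -!exprM => ->.
by rewrite -[_ *+ 2]mulr_natr mulfK.
Qed.

Lemma Rintegral_spectral_poly_density n :
  `|k| * (spectral_poly k n).[1] +
    \int[lambda]_z ((spectral_poly k n).[re z] * circle_density k z) =
  (n == 0)%:R + k * ((1 + k) ^+ (2 * n) - (1 - k) ^+ (2 * n)) / 2.
Proof.
rewrite Rintegral_haar_half_period; last 2 first.
  exact: measurable_trig_density (trig_horner_re _).
  exact: bounded_trig_density (trig_horner_re _).
under eq_Rintegral do rewrite circle_density_expM /circle_expM re_exp.
have pi0 : pi != 0 :> R by rewrite gt_eqF ?pi_gt0.
rewrite spectral_moment// mulKf// horner_spectral_poly1; move: ((n == 0)%:R) => e.
case: (ger0P k) => _; rewrite ?opprK;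
  by move: (_ ^+ (2 * n)) ((_ + _) ^+ (2 * n)) => X Y; field.
Qed.

Lemma Rintegral_im_density q :
  \int[lambda]_z (im z * q.[re z] * circle_density k z) = 0.
Proof.
apply: Rintegral_haar_odd.
- exact: measurable_trig_density (trig_im_horner_re _).
- exact: bounded_trig_density (trig_im_horner_re _).
by move=> t; rewrite /circle_density !re_exp !im_exp cosN sinN !mulNr.
Qed.

Variable mu : probability (circle R) R.
Hypothesis mu_spectral_poly : forall n, \int[mu]_z (spectral_poly k n).[re z] =
  (n == 0)%:R + k * ((1 + k) ^+ (2 * n) - (1 - k) ^+ (2 * n)) / 2.
Hypothesis mu_im : forall q, \int[mu]_z (im z * q.[re z]) = 0.

Lemma spectral_measure_unique B : measurable B ->
  mu B = (`|k|%:E * \d_(circle_one R) B + half_angle_measure (spectral_density k) B)%E.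
Proof.
move=> mB; rewrite half_angle_measureE//.
have mg := measurable_circle_density k.
apply: (@circle_measure_unique R mu lambda `|k|%:nng _ mg (circle_density_itv k) _ B mB).
have re1 : re (circle_one R) = 1 by rewrite re_exp cos0.
have im1 : im (circle_one R) = 0 by rewrite im_exp sin0.
have mu_re (p : {poly R}) : \int[mu]_z p.[re z] =
    `|k| * p.[1] + \int[lambda]_z (p.[re z] * circle_density k z).
  move: p; apply: (poly_graded_ind (size_spectral_poly k)) => [|c p q IHp IHq|n].
  - under eq_Rintegral do rewrite horner0.
    under [in RHS]eq_Rintegral do rewrite horner0 mul0r.
    by rewrite horner0 !Rintegral_cst// !mul0r mulr0 addr0.
  - under eq_Rintegral do rewrite hornerD hornerZ.
    under [in RHS]eq_Rintegral do rewrite hornerD hornerZ.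
    rewrite (Rintegral_trig_linear mu c (trig_horner_re p) (trig_horner_re q)).
    rewrite (Rintegral_trigP lambda c mg norm_density
      (trig_horner_re p) (trig_horner_re q)).
    by rewrite IHp IHq hornerD hornerZ; ring.
  - by rewrite Rintegral_spectral_poly_density mu_spectral_poly.
move=> f [p [q /funext ->]]; rewrite re1 im1 mul0r addr0.
have := Rintegral_trig_linear mu 1 (trig_horner_re p) (trig_im_horner_re q).
under eq_Rintegral do rewrite mul1r.
move=> ->; have := Rintegral_trigP lambda 1 mg norm_density
  (trig_horner_re p) (trig_im_horner_re q).
under eq_Rintegral do rewrite mul1r.
by move=> ->; rewrite mu_im Rintegral_im_density mu_re !mul1r !addr0.
Qed.

Lemma half_angle_measure_dominated :
  half_angle_measure (spectral_density k) `<< @haar_circle R.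
Proof.
move=> N N0 B mB BN; rewrite half_angle_measureE//.
apply: null_set_integral => //.
  by apply/measurable_EFinP/measurable_funTS; exact: measurable_circle_density.
by have := N0 B mB BN; rewrite haar_circleE.
Qed.

End SpectralMeasure.

Lemma haar_dirac_singular (R : realType) (c : \bar R) :
  mutually_singular (@haar_circle R) (fun B => (c * \d_(circle_one R) B)%E).
Proof.
exists [set circle_one R]; split.
- rewrite (_ : [set _] = @re R @^-1` [set 1]).
    by rewrite -[X in measurable X]setTI; exact: measurable_re.
  apply/seteqP; split => z /=; first by move=> ->; rewrite re_exp cos0.
  move=> rz; have := circle_sqr z; rewrite rz expr1n => /eqP.
  rewrite -subr_eq0 addrAC subrr add0r sqrf_eq0 => /eqP iz.
  by apply: val_inj => /=; rewrite circle_valE rz iz cos0 sin0.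
- exact: haar_circle_one.
- by rewrite diracE memNset ?mule0//= => /(_ erefl).
Qed.

Theorem corollary2 (R : realType) (A : algType R[i]) (star : A -> A)
    (tau : {scalar A}) (P U : A) (theta : R)
    (mu_infty : probability (circle R) R) :
  let S := 2 * P - 1 in
  let kappa := 2 * theta - 1 in
  wstar_probability_space star tau ->
  orthogonal_projection star P ->
  tau P = theta%:C ->
  0 < theta <= 1 ->
  haar_unitary star tau U ->
  star_free star tau U P ->
  (forall n : int,
     circle_moment mu_infty n = tau (upow star (S * U * S * star U) n)) ->
  lebesgue_decomposition (@haar_circle R) mu_infty
    (fun B => (`|kappa|%:E * \d_(circle_one R) B)%E)
    (half_angle_measure (spectral_density kappa)).
Proof.
move=> S k wstar projP tauP theta01 haarU freeUP moments.
have k1 : `|k| <= 1 by rewrite ler_norml /k; lra.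
have tr := trace_cheb_projection wstar projP tauP haarU freeUP.
rewrite -/k in tr; clearbody k.
set b := U * S * star U.
have pow n := trace_pow_symmetries U wstar projP n.
have mpos n : circle_moment mu_infty (Posz n) = tau ((S * b) ^+ n).
  by rewrite moments (upow_symmetries U wstar projP).
have mneg n : circle_moment mu_infty (Negz n) = tau ((b * S) ^+ n.+1).
  by rewrite moments (upow_symmetries U wstar projP).
have sym n : circle_moment mu_infty (Posz n.+1) = circle_moment mu_infty (Negz n).
  by rewrite mpos mneg pow.
have im0 := symmetric_im_horner sym.
have tau_pow n : tau ((S * b) ^+ n) = (\int[mu_infty]_z (chebT R n).[re z])%:C.
  by rewrite -mpos circle_moment_pos symmetric_moment_im.
pose x : A := 2^-1 *: (S * b + b * S).
pose ev (p : {poly R}) := horner_alg x (map_poly (real_complex R) p).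
have ev_cheb (y d : {poly R}) n : ev (cheb y d n) = cheb (ev y) (ev d) n.
  by rewrite /ev !rmorph_cheb.
have evX : ev 'X = x by rewrite /ev map_polyX horner_algX.
have evC c : ev c%:P = (c%:C)%:A by rewrite /ev map_polyC/= horner_algC.
have tau_ev p : tau (ev p) = (\int[mu_infty]_z p.[re z])%:C.
  move: p; apply: (poly_graded_ind (@size_chebT R)) => [|c p q IHp IHq|n].
  - under eq_Rintegral do rewrite horner0.
    by rewrite Rintegral_cst// mul0r /ev !rmorph0 linear0.
  - under eq_Rintegral do rewrite hornerD hornerZ.
    rewrite (Rintegral_trig_linear mu_infty c (trig_horner_re p) (trig_horner_re q)).
    have -> : ev (c *: p + q) = c%:C *: ev p + ev q.
      by rewrite /ev rmorphD/= map_polyZ linearD linearZ/= mulr_algl.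
    by rewrite linearP/= IHp IHq rmorphD rmorphM.
  - have ev1 : ev 1 = 1 by rewrite /ev !rmorph1.
    rewrite /chebT ev_cheb evX ev1 (cheb_symmetries projP haarU) linearZ linearD/= -pow.
    by rewrite tau_pow -mulr2n -[X in _ * X]mulr_natl mulKf ?pnatr_eq0.
split.
- move=> B mB; apply: spectral_measure_unique => // n.
  apply: (fmorph_inj (real_complex R)); rewrite -[LHS]tau_ev /spectral_poly ev_cheb.
  have -> : ev ('X + (k ^+ 2)%:P) = x + (k%:C ^+ 2)%:A.
    by rewrite /ev !rmorphD/= -!/(ev _) evX evC rmorphXn.
  rewrite evC !rmorphXn rmorphB rmorph1 rmorphXn tr.
  rewrite rmorphD rmorph_nat !rmorphM fmorphV rmorph_nat rmorphB !rmorphXn.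
  by rewrite rmorphD rmorphB rmorph1.
- exact: half_angle_measure_dominated.
- exact: haar_dirac_singular.
Qed.
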